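(* Let $(\rho,u)$ be a smooth solution of the compressible Navier-Stokes system with complete slip boundary condition in $\Omega=B_1$ such that $$\int_\Omega\rho u\cdot\varphi_i\,dx=\int_\Omega\bar\rho\bar u\cdot\varphi_i\,dx,\quad i=1,2,3,\qquad\text{and}\qquad \bar\rho\ge\inf_{x\in\Omega}\bar\rho>0\ \text{ in }\Omega .$$ Then there is a constant $C>0$, possibly depending on $\sup_\Omega\bar\rho,\inf_\Omega\bar\rho,\Omega,\mu,\lambda$ but not on $\bar\omega,\rho,u$, such that $$\int_\Omega|\nabla(u-\bar u)|^2dx\le C\Big\{\int_\Omega|\nabla u+\nabla u^\top|^2dx+\int_\Omega|\bar u|^2|\rho-\bar\rho|^2dx+\int_\Omega|\rho-\bar\rho|^2|u-\bar u|^2dx+\Big(\int_\Omega u\,dx\Big)^2\Big\}.$$ Moreover, the last term $\big(\int_\Omega u\,dx\big)^2$ on the right-hand side can be dropped.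
   Context: $\Omega=B_1\subset\mathbb R^3$ is the unit ball centred at the origin, $\Gamma=\partial\Omega$ with unit outer normal $\vec n$ and tangential vectors $\vec\tau$. With $\gamma>1$, $\mu,\lambda>0$, $\mathbb S(u)=\mu(\nabla u+\nabla u^\top)+\lambda(\mathrm{div}\,u)\mathbb I_3$, the system is $$\partial_t\rho+\mathrm{div}(\rho u)=0,\quad\partial_t(\rho u)+\mathrm{div}(\rho u\otimes u)+\nabla\rho^\gamma=\mathrm{div}\,\mathbb S(u)\ \text{in }\Omega,\qquad u\cdot\vec n=0,\ \vec\tau\cdot\mathbb S(u)\vec n=0\ \text{on }\Gamma .$$ $\varphi_i(x)=x\times e_i$, $i=1,2,3$, with $e_i$ the standard basis of $\mathbb R^3$. $(\bar\rho,\bar u)$ is the steady state $\bar\rho=(\bar\rho(0)^{\gamma-1}+\frac{\gamma-1}{2\gamma}\bar\omega^2(x_1^2+x_2^2))^{1/(\gamma-1)}$, $\bar u=\bar\omega(x_2,-x_1,0)^\top$, with $\bar\rho(0)>0$, $\bar\omega\ge0$. *)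

(* Defs.v *)
From HB Require Import structures.
From mathcomp Require Import all_boot all_order all_algebra.
From mathcomp Require Import all_classical all_reals all_analysis.

Set Implicit Arguments.
Unset Strict Implicit.
Unset Printing Implicit Defensive.

Import Order.TTheory GRing.Theory Num.Theory numFieldNormedType.Exports.

Local Open Scope classical_set_scope.
Local Open Scope ring_scope.

(* Points and vectors of R^3 are row vectors 'rV[R]_3. The norm `|x| that the
   library puts on 'rV[R]_3 is the sup norm; Euclidean (Frobenius) quantities
   below go through dot and sqnorm. *)

Section Vectors.
Context {R : realType}.

Definition vec3 (a b c : R) : 'rV[R]_3 := \row_i [:: a; b; c]`_i.

Definition dot (x y : 'rV[R]_3) : R := \sum_i x 0 i * y 0 i.

Definition sqnorm m n (A : 'M[R]_(m, n)) : R := \sum_i \sum_j A i j ^+ 2.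

Definition cross (x y : 'rV[R]_3) : 'rV[R]_3 :=
  vec3 (x 0 1 * y 0 2 - x 0 2 * y 0 1)
       (x 0 2 * y 0 0 - x 0 0 * y 0 2)
       (x 0 0 * y 0 1 - x 0 1 * y 0 0).

Definition basis (i : 'I_3) : 'rV[R]_3 := delta_mx 0 i.

Definition unit_ball : set 'rV[R]_3 := [set x | dot x x < 1].

Definition unit_cball : set 'rV[R]_3 := [set x | dot x x <= 1].

(* On the unit sphere the outer unit normal at x is x itself. *)
Definition unit_sphere : set 'rV[R]_3 := [set x | dot x x = 1].

(* The library has no Lebesgue measure on 'rV[R]_3: integrate over the threefold
   product of the Lebesgue measure on the line, through coordinates. *)
Definition coords (p : measurableTypeR R * measurableTypeR R * measurableTypeR R)
    : 'rV[R]_3 :=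
  vec3 p.1.1 p.1.2 p.2.

Definition integral3 (D : set 'rV[R]_3) (f : 'rV[R]_3 -> R) : R :=
  Rintegral ((lebesgue_measure \x lebesgue_measure) \x lebesgue_measure)%E
    (coords @^-1` D) (f \o coords).

Definition vintegral3 (D : set 'rV[R]_3) (f : 'rV[R]_3 -> 'rV[R]_3) : 'rV[R]_3 :=
  \row_i integral3 D (fun x => f x 0 i).

End Vectors.

Section Calculus.
Context {R : realType}.

Definition partial (i : 'I_3) (f : 'rV[R]_3 -> R) (x : 'rV[R]_3) : R :=
  'D_(basis i) f x.

Definition grad (f : 'rV[R]_3 -> R) (x : 'rV[R]_3) : 'rV[R]_3 :=
  \row_i partial i f x.

Definition vgrad (u : 'rV[R]_3 -> 'rV[R]_3) (x : 'rV[R]_3) : 'M[R]_3 :=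
  \matrix_(i, j) partial i (fun y => u y 0 j) x.

Definition divergence (u : 'rV[R]_3 -> 'rV[R]_3) (x : 'rV[R]_3) : R :=
  \sum_i partial i (fun y => u y 0 i) x.

Definition mdivergence (A : 'rV[R]_3 -> 'M[R]_3) (x : 'rV[R]_3) : 'rV[R]_3 :=
  \row_i \sum_j partial j (fun y => A y i j) x.

Definition tensor (u v : 'rV[R]_3) : 'M[R]_3 := \matrix_(i, j) (u 0 i * v 0 j).

Definition stress (mu lambda : R) (u : 'rV[R]_3 -> 'rV[R]_3) (x : 'rV[R]_3)
    : 'M[R]_3 :=
  mu *: (vgrad u x + (vgrad u x)^T) + lambda *: (divergence u x)%:M.

(* C^oo on O: all iterated directional derivatives exist and are continuous. *)
Definition smooth_on (V : normedModType R) (O : set V) (f : V -> R) : Prop :=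
  forall (vs : seq V) (x : V), O x ->
    let g := foldr (fun v h => fun y => 'D_v h y) f vs in
    {for x, continuous g} /\ forall v, derivable g x v.

(* C^oo up to the boundary of K: C^oo on an open neighbourhood of K. *)
Definition smooth_upto (V : normedModType R) (K : set V) (f : V -> R) : Prop :=
  exists O : set V, [/\ open O, K `<=` O & smooth_on O f].

End Calculus.

Section NavierStokes.
Context {R : realType}.

(* A smooth solution on the time interval I. The density is only required to be
   nonnegative, so that rho^gamma makes sense for real gamma. In the slip condition
   n = x, and x *m S^T is S n written as a row vector. *)
Record smooth_slip_solution (gamma mu lambda : R) (I : interval R)
    (rho : R -> 'rV[R]_3 -> R) (u : R -> 'rV[R]_3 -> 'rV[R]_3) : Prop := {
  sol_smooth_rho :
    smooth_upto ([set` I] `*` unit_cball) (fun p : R * 'rV[R]_3 => rho p.1 p.2);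
  sol_smooth_u : forall i : 'I_3,
    smooth_upto ([set` I] `*` unit_cball)
      (fun p : R * 'rV[R]_3 => u p.1 p.2 0 i);
  sol_rho_ge0 : forall t x, t \in I -> unit_ball x -> 0 <= rho t x;
  sol_mass : forall t x, t \in I -> unit_ball x ->
    derive1 (fun s => rho s x) t + divergence (fun y => rho t y *: u t y) x = 0;
  sol_momentum : forall t x, t \in I -> unit_ball x ->
    (\row_i derive1 (fun s => rho s x * u s x 0 i) t)
    + mdivergence (fun y => rho t y *: tensor (u t y) (u t y)) x
    + grad (fun y => rho t y `^ gamma) x
    = mdivergence (stress mu lambda (u t)) x;
  sol_no_flux : forall t x, t \in I -> unit_sphere x -> dot (u t x) x = 0;
  sol_slip : forall t x (tau : 'rV[R]_3), t \in I -> unit_sphere x ->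
    dot tau x = 0 -> dot tau (x *m (stress mu lambda (u t) x)^T) = 0
}.

Definition phi (i : 'I_3) (x : 'rV[R]_3) : 'rV[R]_3 := cross x (basis i).

(* The steady state; rho0 is the density at the origin. *)
Definition rhobar (gamma rho0 omega : R) (x : 'rV[R]_3) : R :=
  (rho0 `^ (gamma - 1)
   + (gamma - 1) / (2 * gamma) * omega ^+ 2 * (x 0 0 ^+ 2 + x 0 1 ^+ 2))
  `^ (gamma - 1)^-1.

Definition ubar (omega : R) (x : 'rV[R]_3) : 'rV[R]_3 :=
  omega *: vec3 (x 0 1) (- x 0 0) 0.

End NavierStokes.

(* Main.v *)
(* At a fixed time put v = u - ubar, a field tangential to the sphere with the same strain
   as u, and write D = grad v + grad v^T.
   - The divergence theorem for tangential fields, applied to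
     (v . grad) v - v div v + x |v|^2 + 2 v (x . v), which is tangential because
     differentiating v . x = 0 along v gives x . (v . grad) v = - |v|^2 on the sphere, yields
     int |grad v|^2 <= 3/2 int |D|^2 + 7 int |v|^2.
   - For a tangential w whose moments int w_i x_j are symmetric, integrating
     ((w(y) - w(x)) . (y - x))^2 <= C int_0^1 |D|^2(x + s (y - x)) ds over pairs of points and
     expanding the left-hand side gives int |w|^2 <= C int |D|^2. Subtracting a rotation
     r = a x x (cross product) from v makes the moments symmetric and does not change D.
   - int rhobar |r|^2 = int rhobar v . r - int rhobar (v - r) . r, and the momentum condition
     turns int rhobar v . r into - int (rho - rhobar) (v + ubar) . r, so that r, hence v, is
     controlled by the right-hand side (already without the mean of u). *)

(* The rigid motions tangential to the sphere are exactly the rotations; they have no strain, so [D]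
   controls [v] only up to one of them, and the angular momentum condition has to fix that one. The
   field [ubar] is itself such a rotation, with angular vector [omega e_3], which is why subtracting
   it leaves the strain alone. Constants are built by hand rather than by compactness, and [rhobar]
   enters them only through its two bounds; this is what keeps them independent of [omega]. In the
   expansion of the double integral the coercive term is [vol / 5] times int |w|^2, because int x_i
   x_j is [vol / 5] times the identity matrix. The one term that the strain cannot compensate is the
   sum of M_ij M_ji over the moments M_ij = int w_i x_j: it is a sum of squares if M is symmetric,
   and minus a sum of squares if M is antisymmetric. The moments of rotations are precisely the
   antisymmetric matrices, so a rotation can always be chosen to remove the harmful part. *)
Require Import Defs.
From HB Require Import structures.
From mathcomp Require Import all_boot all_order all_algebra.
From mathcomp Require Import all_classical all_reals all_analysis.
From mathcomp Require Import measurable_realfun zify ring lra.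

Set Implicit Arguments.
Unset Strict Implicit.
Unset Printing Implicit Defensive.

Import Order.TTheory GRing.Theory Num.Theory numFieldNormedType.Exports.

Local Open Scope classical_set_scope.
Local Open Scope ring_scope.

(** * Bounded functions with support of finite measure *)

Section SigmaFiniteProduct.
Context d1 d2 (T1 : measurableType d1) (T2 : measurableType d2) (R : realType).
Variables (m1 : {sigma_finite_measure set T1 -> \bar R})
  (m2 : {sigma_finite_measure set T2 -> \bar R}).

(* The instance that mathcomp-analysis declares on [m1 \x m2] is shadowed by the
   one on products of subprobabilities, hence this alias. *)
Definition sfprod : set (T1 * T2) -> \bar R := (m1 \x m2)%E.

HB.instance Definition _ := Measure.on sfprod.

Lemma sfprodE A B : measurable A -> measurable B ->
  sfprod (A `*` B) = (m1 A * m2 B)%E.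
Proof. exact: product_measure1E. Qed.

Lemma sigma_finite_sfprod : sigma_finite setT sfprod.
Proof.
have /sigma_finiteP[F [TF ndF Foo]] := sigma_finiteT m1.
have /sigma_finiteP[G [TG ndG Goo]] := sigma_finiteT m2.
exists (fun n => F n `*` G n).
  apply/seteqP; split => // -[x y] _.
  have [n _ Fn] : (\bigcup_n F n) x by rewrite -TF.
  have [k _ Gk] : (\bigcup_n G n) y by rewrite -TG.
  exists (maxn n k) => //; split => /=.
  - by move: x Fn; apply/subsetPset/ndF/leq_maxl.
  - by move: y Gk; apply/subsetPset/ndG/leq_maxr.
move=> k; have [mF Fk] := Foo k; have [mG Gk] := Goo k.
split; first exact: measurableX.
by rewrite sfprodE// lte_mul_pinfty// ge0_fin_numE.
Qed.

HB.instance Definition _ :=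
  Measure_isSigmaFinite.Build _ _ _ sfprod sigma_finite_sfprod.

End SigmaFiniteProduct.

Section BoundedSupport.
Context {R : realType}.

Definition finite_set_measure d (T : measurableType d)
    (mu : set T -> \bar R) (A : set T) :=
  measurable A /\ (mu A < +oo)%E.

(** Stable under sums, products, sections and partial integrals, and integrable once [A] has finite
    measure: Fubini then applies without separate integrability arguments. With [A = setT] it only
    says bounded and measurable. *)
Definition bsupp d (T : measurableType d) (A : set T) (f : T -> R) :=
  [/\ measurable_fun setT f, (exists M : R, forall x, `|f x| <= M) &
      forall x, ~ A x -> f x = 0].

Section OneMeasure.
Context d (T : measurableType d) (mu : {measure set T -> \bar R}) (A : set T).
Hypothesis finA : finite_set_measure mu A.

Lemma bsupp_restrict (f : T -> R) : bsupp A f -> f \_ A = f.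
Proof.
move=> [_ _ f0]; apply/funext => x; rewrite patchE.
by case: ifPn => // /negP xA; rewrite f0// => Ax; apply: xA; rewrite inE.
Qed.

Lemma bsupp_integrable f : bsupp A f -> mu.-integrable setT (EFin \o f).
Proof.
move=> bf; have := bf => -[mf [M fM] f0]; case: (finA) => mA Afin.
have : mu.-integrable A (EFin \o f).
  apply: measurable_bounded_integrable => //; first exact: measurable_funTS.
  by exists M; split; [exact: num_real|move=> r Mr x _; exact: le_trans (fM x) (ltW Mr)].
move=> /(integrable_mkcond _ mA); rewrite (_ : _ \_ _ = EFin \o f)//.
by rewrite restrict_EFin bsupp_restrict.
Qed.

Lemma bsupp_Rintegral_bound (f : T -> R) M : bsupp A f ->
  (forall x, `|f x| <= M) -> `|\int[mu]_x f x| <= M * fine (mu A).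
Proof.
move=> bf fM; case: (finA) => mA Afin.
have iM : mu.-integrable setT (EFin \o (cst M \_ A)).
  apply: bsupp_integrable; split.
  - by apply/(measurable_restrictT _ mA); exact: measurable_cst.
  - by exists `|M| => x; rewrite patchE; case: ifP; rewrite // normr0.
  - by move=> x Ax; rewrite patchE; case: ifPn => //; rewrite inE.
have fi := bsupp_integrable bf.
apply: le_trans (le_normr_Rintegral measurableT fi) _.
rewrite -(Rintegral_cst mu mA) [leRHS]Rintegral_mkcond.
apply: le_Rintegral => //.
  rewrite (_ : _ \o _ = (abse \o (EFin \o f))%E)//.
  exact/(integrable_abse fi).
move=> x _; rewrite patchE; case: ifPn => [//|xA].
case: bf => _ _ ->; rewrite ?normr0// => Ax.
by move/negP: xA; apply; rewrite inE.
Qed.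

Lemma bsuppN f : bsupp A f -> bsupp A (fun x => - f x).
Proof.
move=> [mf [M fM] f0]; split.
- exact: measurableT_comp.
- by exists M => x; rewrite normrN.
- by move=> x Ax; rewrite f0// oppr0.
Qed.

Lemma bsupp_bounded f : bsupp A f -> bsupp setT f.
Proof. by move=> [mf fM _]; split=> // x []. Qed.

Lemma bsuppM f g : bsupp A f -> bsupp A g -> bsupp A (fun x => f x * g x).
Proof.
move=> [mf [M fM] f0] [mg [N gN] _]; split.
- exact: measurable_funM.
- exists (M * N) => x; rewrite normrM; exact: ler_pM.
- by move=> x /f0 ->; rewrite mul0r.
Qed.

Lemma bsuppD f g : bsupp A f -> bsupp A g -> bsupp A (fun x => f x + g x).
Proof.
move=> [mf [M fM] f0] [mg [N gN] g0]; split.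
- exact: measurable_funD.
- by exists (M + N) => x; rewrite (le_trans (ler_normD _ _))// lerD.
- by move=> x Ax; rewrite f0// g0// addr0.
Qed.

Lemma bsuppZ (c : R) f : bsupp A f -> bsupp A (fun x => c * f x).
Proof.
move=> [mf [M fM] f0]; split.
- exact: measurable_funM.
- by exists (`|c| * M) => x; rewrite normrM ler_wpM2l.
- by move=> x /f0 ->; rewrite mulr0.
Qed.

End OneMeasure.

Lemma bsupp_comp d1 d2 (T1 : measurableType d1) (T2 : measurableType d2)
    (h : T1 -> T2) (f : T2 -> R) : measurable_fun setT h ->
  bsupp setT f -> bsupp setT (f \o h).
Proof.
move=> mh [mf [M fM] _]; split=> //; first exact: measurableT_comp.
  by exists M => x; exact: fM.
by move=> x [].
Qed.

Section TwoMeasures.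
Context d1 d2 (T1 : measurableType d1) (T2 : measurableType d2).
Variables (m1 : {sigma_finite_measure set T1 -> \bar R})
  (m2 : {sigma_finite_measure set T2 -> \bar R}).
Variables (A : set T1) (B : set T2).
Hypotheses (finA : finite_set_measure m1 A) (finB : finite_set_measure m2 B).

Lemma finite_set_measureX : finite_set_measure (sfprod m1 m2) (A `*` B).
Proof.
case: finA finB => [mA Af] [mB Bf].
split; first exact: measurableX.
by rewrite sfprodE// lte_mul_pinfty// ge0_fin_numE.
Qed.

Variable f : T1 * T2 -> R.
Hypothesis bf : bsupp (A `*` B) f.

Lemma bsupp_section1 x : bsupp B (fun y => f (x, y)).
Proof.
case: bf => mf [M fM] f0; split.
- exact: (measurableT_comp mf (pair1_measurable x)).
- by exists M.
- by move=> y By; apply: f0 => -[].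
Qed.

Lemma bsupp_section2 y : bsupp A (fun x => f (x, y)).
Proof.
case: bf => mf [M fM] f0; split.
- exact: (measurableT_comp mf (pair2_measurable y)).
- by exists M.
- by move=> x Ax; apply: f0 => -[].
Qed.

Lemma EFin_Rint1 x :
  (\int[m2]_y f (x, y))%:E = (\int[m2]_y (f (x, y))%:E)%E.
Proof.
rewrite /Rintegral fineK//; apply: integrable_fin_num => //.
exact: (bsupp_integrable finB (bsupp_section1 x)).
Qed.

Lemma EFin_Rint2 y :
  (\int[m1]_x f (x, y))%:E = (\int[m1]_x (f (x, y))%:E)%E.
Proof.
rewrite /Rintegral fineK//; apply: integrable_fin_num => //.
exact: (bsupp_integrable finA (bsupp_section2 y)).
Qed.

Let fi := bsupp_integrable finite_set_measureX bf.

Lemma bsupp_Rint1 : bsupp A (fun x => \int[m2]_y f (x, y)).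
Proof.
case: bf => mf [M fM] f0; split.
- apply/measurable_EFinP; rewrite (_ : _ \o _ = fubini_F m2 (EFin \o f)).
    exact: (measurable_fubini_F fi).
  by apply/funext => x /=; rewrite EFin_Rint1.
- exists (M * fine (m2 B)) => x.
  exact: (bsupp_Rintegral_bound finB (bsupp_section1 x)).
- move=> x Ax; rewrite (_ : (fun y => f (x, y)) = cst 0).
    by rewrite Rintegral_cst// mul0r.
  by apply/funext => y; rewrite f0// => -[].
Qed.

Lemma bsupp_Rint2 : bsupp B (fun y => \int[m1]_x f (x, y)).
Proof.
case: bf => mf [M fM] f0; split.
- apply/measurable_EFinP; rewrite (_ : _ \o _ = fubini_G m1 (EFin \o f)).
    exact: (measurable_fubini_G fi).
  by apply/funext => x /=; rewrite EFin_Rint2.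
- exists (M * fine (m1 A)) => x.
  exact: (bsupp_Rintegral_bound finA (bsupp_section2 x)).
- move=> x Ax; rewrite (_ : (fun y => f (y, x)) = cst 0).
    by rewrite Rintegral_cst// mul0r.
  by apply/funext => y; rewrite f0// => -[].
Qed.

Lemma Rintegral_fubini1 :
  \int[sfprod m1 m2]_z f z = \int[m1]_x \int[m2]_y f (x, y).
Proof.
rewrite {1}/Rintegral -(integral12_prod_meas1 fi); congr fine.
by apply: eq_integral => x _; rewrite EFin_Rint1.
Qed.

Lemma Rintegral_fubini2 :
  \int[sfprod m1 m2]_z f z = \int[m2]_y \int[m1]_x f (x, y).
Proof.
rewrite {1}/Rintegral -(integral21_prod_meas1 fi); congr fine.
by apply: eq_integral => x _; rewrite EFin_Rint2.
Qed.

End TwoMeasures.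

Definition measure_preserving d (T : measurableType d) (m : set T -> \bar R)
    (s : T -> T) :=
  measurable_fun setT s /\ forall A, measurable A -> m (s @^-1` A) = m A.

Lemma Rintegral_preserving d (T : measurableType d) (m : {measure set T -> \bar R})
    (s : T -> T) (f : T -> R) : measure_preserving m s -> measurable_fun setT f ->
  \int[m]_x f (s x) = \int[m]_x f x.
Proof.
move=> [ms sE] mf; rewrite /Rintegral; congr fine.
have mf' : measurable_fun setT (EFin \o f) by exact/measurable_EFinP.
have pos (g : T -> \bar R) : measurable_fun setT g -> (forall x, 0 <= g x)%E ->
    (\int[m]_x g (s x) = \int[m]_x g x)%E.
  move=> mg g0; transitivity (\int[pushforward m s]_x g x)%E.
    by rewrite ge0_integral_pushforward.
  by apply: eq_measure_integral => //= A mA _; exact: sE.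
rewrite integralE [RHS]integralE; congr (_ - _)%E.
  rewrite -(pos (EFin \o f)^\+%E (measurable_funepos mf'))//.
  by apply: eq_integral => x _; rewrite !funeposE.
rewrite -(pos (EFin \o f)^\-%E (measurable_funeneg mf'))//.
by apply: eq_integral => x _; rewrite !funenegE.
Qed.

Lemma measure_preserving_shift (c : R) :
  measure_preserving (@lebesgue_measure R)
    (fun x : measurableTypeR R => (x + c : measurableTypeR R)).
Proof.
have mc : measurable_fun [set: R] (fun x : R => (x + c : measurableTypeR R)).
  exact: measurable_funD.
split=> // A mA; apply/esym.
apply: (@lebesgue_measure_unique R (pushforward (@lebesgue_measure R)
  (fun x : R => (x + c : measurableTypeR R)))) => //= _ [[a b]] _ <-.
rewrite /pushforward.
have -> : (fun x : R => x + c) @^-1` `]a, b]%classic = `]a - c, b - c]%classic.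
  by apply/seteqP; split => x /=; rewrite !in_itv/= ltrBlDr lerBrDr.
rewrite !lebesgue_measure_itv/= !lte_fin ltrD2r.
by case: ifP => // _; rewrite -!EFinB; congr EFin; ring.
Qed.

Lemma measure_preservingX d1 d2 (T1 : measurableType d1) (T2 : measurableType d2)
    (m1 : {sigma_finite_measure set T1 -> \bar R})
    (m2 : {sigma_finite_measure set T2 -> \bar R}) s1 s2 :
  measure_preserving m1 s1 -> measure_preserving m2 s2 ->
  measure_preserving (sfprod m1 m2) (fun p => (s1 p.1, s2 p.2)).
Proof.
move=> [ms1 s1E] [ms2 s2E].
have ms : measurable_fun setT (fun p : T1 * T2 => (s1 p.1, s2 p.2)).
  exact: measurable_fun_pair (measurableT_comp ms1 measurable_fst)
    (measurableT_comp ms2 measurable_snd).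
split=> // X mX.
apply/esym/(@product_measure_unique _ _ _ _ _ m1 m2
  (pushforward (sfprod m1 m2) (fun p : T1 * T2 => (s1 p.1, s2 p.2)))) => // A B mA mB.
have mA' : measurable (s1 @^-1` A) by rewrite -[_ @^-1` _]setTI; exact: ms1.
have mB' : measurable (s2 @^-1` B) by rewrite -[_ @^-1` _]setTI; exact: ms2.
by rewrite -(s1E A mA) -(s2E B mB); exact: (sfprodE m1 m2 mA' mB').
Qed.

End BoundedSupport.

(** * Continuous functions on the closed ball *)

Section Borel3.
Context {R : realType}.
Local Notation leb := (@lebesgue_measure R).
Local Notation T3 := (measurableTypeR R * measurableTypeR R * measurableTypeR R)%type.
Local Notation V := 'rV[R]_3.

Local Notation mu2 := (sfprod leb leb).
Local Notation mu3 := (sfprod mu2 leb).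

Lemma coordsE (p : T3) : (coords p 0 0 = p.1.1) * (coords p 0 1 = p.1.2) * (coords p 0 2 = p.2).
Proof. by rewrite !mxE. Qed.

Lemma ord3P (P : 'I_3 -> Prop) : P 0 -> P 1 -> P 2 -> forall i, P i.
Proof.
move=> P0 P1 P2 [[|[|[|//]]] i3].
- by rewrite (_ : Ordinal _ = 0)//; apply: val_inj.
- by rewrite (_ : Ordinal _ = 1)//; apply: val_inj.
- by rewrite (_ : Ordinal _ = 2)//; apply: val_inj.
Qed.

Lemma sum3 (F : 'I_3 -> R) : \sum_i F i = F 0 + F 1 + F 2.
Proof.
rewrite !big_ord_recr big_ord0 /= add0r; congr (F _ + F _ + F _); exact: val_inj.
Qed.

Lemma measurable_coords_ball (c : V) (e : R) : 0 < e ->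
  measurable (coords @^-1` ball c e : set T3).
Proof.
move=> e0; rewrite (_ : _ @^-1` _ =
  (ball (c 0 0) e `*` ball (c 0 1) e) `*` ball (c 0 2) e).
  by apply: measurableX; [apply: measurableX|]; exact: measurable_ball.
apply/seteqP; split => [[[x y] z] /= h|[[x y] z] /= [[h0 h1] h2]].
  have [_ {}h] : 0 < e /\ forall i j, ball (c i j) e (coords (x, y, z) i j) := h.
  by split; [split|]; [have := h 0 0|have := h 0 1|have := h 0 2]; rewrite coordsE.
by split=> // i; rewrite ord1; elim/ord3P; rewrite coordsE.
Qed.

(** Sup-norm balls pull back to boxes, and an open set is the countable union of those balls inside
    it that have a rational centre and radius [1 / (n + 1)]. *)
Lemma measurable_coords_open (U : set V) : open U -> measurable (coords @^-1` U : set T3).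
Proof.
move=> oU.
pose q (a : rat * rat * rat) : V := coords (ratr a.1.1, ratr a.1.2, ratr a.2).
pose F (a : (rat * rat * rat) * nat) : set T3 :=
  if pselect (ball (q a.1) a.2.+1%:R^-1 `<=` U) then coords @^-1` ball (q a.1) a.2.+1%:R^-1 else set0.
rewrite (_ : _ @^-1` _ = \bigcup_a F a).
  apply: countable_bigcupT_measurable; first exact: countableP.
  move=> a; rewrite /F; case: (pselect _) => //= _.
  by apply: measurable_coords_ball; rewrite invr_gt0.
apply/seteqP; split => [p /= Up|p [a _]]; last first.
  by rewrite /F; case: pselect => // h /h.
have /nbhs_ballP [e /= e0 eU] := open_nbhs_nbhs (conj oU Up).
(* Half of [e], since a ball containing [coords p] reaches at most twice its radius away from it. *)
have [n ne] : exists n : nat, n.+1%:R^-1 < e / 2.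
  exists (Num.truncn (e / 2)^-1).
  rewrite invf_plt ?posrE// ?divr_gt0//; exact: truncnS_gt.
have rat_near (x : R) : exists r : rat, ball (ratr r : R) n.+1%:R^-1 x.
  have [|y [/= xy [r _ ry]]] := @dense_rat R (ball x n.+1%:R^-1) _ (ball_open _ _).
    by exists x; exact: ballxx.
  by exists r; rewrite ry; exact: ball_sym.
have [r0 h0] := rat_near p.1.1.
have [r1 h1] := rat_near p.1.2.
have [r2 h2] := rat_near p.2.
exists ((r0, r1, r2), n) => //.
have pq : ball (q (r0, r1, r2)) n.+1%:R^-1 (coords p).
  by split=> [|i]; rewrite ?invr_gt0// ord1; elim/ord3P; rewrite !coordsE.
rewrite /F; case: pselect => // -[] /= y qy; apply: eU.
have le_e : n.+1%:R^-1 + n.+1%:R^-1 <= e.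
  by apply: ltW; rewrite [ltRHS]splitr; exact: ltrD.
apply: (le_ball le_e).
by apply: ball_triangle qy; exact: ball_sym.
Qed.

Lemma dot3E (x y : V) : dot x y = x 0 0 * y 0 0 + x 0 1 * y 0 1 + x 0 2 * y 0 2.
Proof. by rewrite /dot sum3. Qed.

Lemma coord_cont i (x : V) : {for x, continuous (fun y : V => y 0 i)}.
Proof. exact: coord_continuous. Qed.

Lemma dot_cont (x : V) : {for x, continuous (fun y : V => dot y y)}.
Proof.
rewrite (_ : (fun y => _) = (fun y : V => y 0 0 * y 0 0 + y 0 1 * y 0 1 + y 0 2 * y 0 2)).
  by apply: continuousD; [apply: continuousD|]; apply: continuousM; exact: coord_cont.
by apply/funext => y; rewrite dot3E.
Qed.

Lemma open_unit_ball : open (unit_ball : set V).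
Proof.
rewrite (_ : unit_ball = (fun y : V => dot y y) @^-1` [set r | r < 1])//.
by apply: open_comp => [y _|]; [exact: dot_cont|exact: open_lt].
Qed.

Lemma sqr_coord_le_dot (x : V) i : x 0 i ^+ 2 <= dot x x.
Proof.
rewrite /dot (bigD1 i)//= -expr2 lerDl; apply: sumr_ge0 => j _.
by rewrite -expr2 sqr_ge0.
Qed.

Lemma dot_ge0 (x : V) : 0 <= dot x x.
Proof. by apply: sumr_ge0 => j _; rewrite -expr2 sqr_ge0. Qed.

Lemma unit_cball_coord (x : V) i : unit_cball x -> `|x 0 i| <= 1.
Proof.
move=> x1; rewrite -(@ler_pXn2r _ 2)// ?nnegrE// expr1n real_normK ?num_real//.
exact: le_trans (sqr_coord_le_dot x i) x1.
Qed.

Lemma unit_ballW (x : V) : unit_ball x -> unit_cball x.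
Proof. exact: ltW. Qed.

Lemma compact_unit_cball : compact (unit_cball : set V).
Proof.
apply: bounded_closed_compact.
  exists 1; split => // M M1 x xB /=.
  rewrite [`|x|]mx_normrE; apply: bigmax_le => [|[i j] _]; first by rewrite ltW// (lt_trans _ M1).
  by rewrite ord1; apply: le_trans (ltW M1); exact: unit_cball_coord.
rewrite (_ : unit_cball = (fun y : V => dot y y) @^-1` [set r | r <= 1])//.
by apply: closed_comp => [y _|]; [exact: dot_cont|exact: closed_le].
Qed.

(** Continuity in full neighbourhoods, also at points of the sphere, and not relative to the closed
    ball: the data are smooth on an open set containing it. *)
Definition cont (f : V -> R) := forall x, unit_cball x -> {for x, continuous f}.

Lemma cont_bounded f : cont f -> exists2 M, 0 <= M & forall x, unit_cball x -> `|f x| <= M.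
Proof.
move=> cf.
have cf' : {within unit_cball, continuous f}.
  by apply: continuous_in_subspaceT => x; rewrite inE => /cf.
have /compact_bounded [M [_ HM]] := continuous_compact cf' compact_unit_cball.
exists (`|M| + 1); first by rewrite addr_ge0.
move=> x xB; apply: (HM (`|M| + 1) _ (f x)); last by exists x.
by rewrite (le_lt_trans (ler_norm _))// ltrDl.
Qed.

Definition ball3 : set T3 := coords @^-1` unit_ball.
Definition box3 : set T3 := (`[-1, 1]%classic `*` `[-1, 1]%classic) `*` `[-1, 1]%classic.

Lemma measurable_ball3 : measurable ball3.
Proof. exact: (measurable_coords_open open_unit_ball). Qed.

Lemma finite_itv (a b : R) :
  finite_set_measure leb (`[a, b]%classic : set (measurableTypeR R)).
Proof.
split => //; rewrite lebesgue_measure_itv/=.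
by case: ifP => // _; rewrite -EFinB ltry.
Qed.

Lemma finite_box3 : finite_set_measure mu3 box3.
Proof.
have f1 := finite_itv (-1) 1.
exact: finite_set_measureX (finite_set_measureX f1 f1) f1.
Qed.

Lemma ball3_box3 : ball3 `<=` box3.
Proof.
move=> p /unit_ballW h; split; [split|]; rewrite /= in_itv /= -ler_norml.
- by have := unit_cball_coord 0 h; rewrite coordsE.
- by have := unit_cball_coord 1 h; rewrite coordsE.
- by have := unit_cball_coord 2 h; rewrite coordsE.
Qed.

(** Extension by zero turns integrals over the ball into integrals over all triples, where
    translations and iterated integrals need no care for domains. *)
Definition ext (f : V -> R) : T3 -> R := (f \o coords) \_ ball3.

Lemma extE f p : unit_ball (coords p) -> ext f p = f (coords p).
Proof. by move=> h; rewrite /ext patchE mem_set. Qed.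

Lemma ext0 f p : ~ unit_ball (coords p) -> ext f p = 0.
Proof. by move=> h; rewrite /ext patchE memNset. Qed.

Lemma cont_measurable f : cont f -> measurable_fun ball3 (f \o coords).
Proof.
move=> cf; apply: (measurability _ (RGenOInfty.measurableE R)).
move=> _ [_ [a ->] <-].
rewrite (_ : _ `&` _ = coords @^-1` (unit_ball `&` [set x | a < f x])); last first.
  by apply/seteqP; split => p /=; rewrite in_itv/= andbT.
apply: measurable_coords_open; rewrite openE => x [x1 ax]; apply: filterI.
  exact: (open_nbhs_nbhs (conj open_unit_ball x1)).
have cfx := cf x (unit_ballW x1).
exact: (cfx _ (open_nbhs_nbhs (conj (@open_gt _ a) ax))).
Qed.

Lemma cont_bsupp f : cont f -> bsupp box3 (ext f).
Proof.
move=> cf; split.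
- apply/(measurable_restrictT _ measurable_ball3); exact: cont_measurable.
- have [M M0 fM] := cont_bounded cf; exists M => p.
  have [pB|pB] := pselect (unit_ball (coords p)).
    by rewrite extE// fM//; exact: unit_ballW.
  by rewrite ext0// normr0.
- by move=> p pb; rewrite ext0// => /ball3_box3.
Qed.

Lemma integral3E f : integral3 unit_ball f = \int[mu3]_p ext f p.
Proof. exact: Rintegral_mkcond. Qed.

Lemma cont_integrable (f : V -> R) : cont f -> mu3.-integrable setT (EFin \o ext f).
Proof. move=> cf; exact: (@bsupp_integrable _ _ _ mu3 box3 finite_box3 _ (cont_bsupp cf)). Qed.

Lemma integral3_eq (f g : V -> R) : (forall x, unit_ball x -> f x = g x) ->
  integral3 unit_ball f = integral3 unit_ball g.
Proof.
by move=> fg; apply: eq_Rintegral => p; rewrite inE => /fg.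
Qed.

Lemma integral3D f g : cont f -> cont g ->
  integral3 unit_ball (fun x => f x + g x) =
  integral3 unit_ball f + integral3 unit_ball g.
Proof.
move=> cf cg; rewrite !integral3E -RintegralD//; [|exact: cont_integrable..].
apply: eq_Rintegral => p _.
have [pB|pB] := pselect (unit_ball (coords p)); first by rewrite !extE.
by rewrite !ext0// addr0.
Qed.

Lemma integral3Z c f : cont f ->
  integral3 unit_ball (fun x => c * f x) = c * integral3 unit_ball f.
Proof.
move=> cf; rewrite !integral3E -RintegralZl//; [|exact: cont_integrable].
apply: eq_Rintegral => p _.
have [pB|pB] := pselect (unit_ball (coords p)); first by rewrite !extE.
by rewrite !ext0// mulr0.
Qed.

Lemma integral3_le f g : cont f -> cont g ->
  (forall x, unit_ball x -> f x <= g x) ->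
  integral3 unit_ball f <= integral3 unit_ball g.
Proof.
move=> cf cg fg; rewrite !integral3E; apply: le_Rintegral => //;
  [exact: cont_integrable..|] => p _.
have [pB|pB] := pselect (unit_ball (coords p)); first by rewrite !extE// fg.
by rewrite !ext0.
Qed.

End Borel3.

(** * Partial derivatives up to the sphere and integration along lines *)

Section Gradient.
Context {R : realType}.
Local Notation leb := (@lebesgue_measure R).
Local Notation T3 := (measurableTypeR R * measurableTypeR R * measurableTypeR R)%type.
Local Notation V := 'rV[R]_3.
Local Notation basis := (@Defs.basis R).
Local Notation mu2 := (sfprod leb leb).
Local Notation mu3 := (sfprod mu2 leb).

Lemma is_derive_line (f : V -> R) (c v : V) (s d : R) :
  is_derive (c + s *: v) v f d -> is_derive s 1 (fun t : R => f (c + t *: v)) d.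
Proof.
have E : (fun h : R => h^-1 *: (((fun t : R => f (c + t *: v)) \o shift s) (h *: 1) - f (c + s *: v)))
       = (fun h => h^-1 *: ((f \o shift (c + s *: v)) (h *: v) - f (c + s *: v))).
  apply/funext => h /=; congr (_ *: (f _ - _)).
  by rewrite [h *: 1]mulr1 scalerDl addrCA.
by move=> [df <-]; split; rewrite /derivable /derive /= E.
Qed.

Lemma line_continuous (c v : V) (s : R) : {for s, continuous (fun t : R => c + t *: v)}.
Proof.
apply: cvgD; first exact: cvg_cst.
by apply: cvgZr_tmp; exact: cvg_id.
Qed.

Lemma continuous_line (f : V -> R) (c v : V) (s : R) :
  {for c + s *: v, continuous f} -> {for s, continuous (fun t : R => f (c + t *: v))}.
Proof.
move=> cf.
by apply: continuous_comp; [exact: line_continuous|exact: cf].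
Qed.

Lemma FTC2_continuous (F f : R -> R) (a b : R) : a < b ->
  (forall s, a <= s <= b -> {for s, continuous f}) ->
  (forall s, a <= s <= b -> {for s, continuous F}) ->
  (forall s, a < s < b -> is_derive s 1 F (f s)) ->
  (\int[leb]_(s in `[a, b]) (f s)%:E = (F b - F a)%:E)%E.
Proof.
move=> ab cf cF dF; rewrite (@continuous_FTC2 _ f F)//.
- by apply: continuous_in_subspaceT => s; rewrite inE/= in_itv/= => /cf.
- split.
  + by move=> s; rewrite in_itv/= => /dF [].
  + by apply: cvg_at_right_filter; apply: cF; rewrite lexx ltW.
  + by apply: cvg_at_left_filter; apply: cF; rewrite lexx ltW.
- by move=> s; rewrite in_itv/= => /dF [_]; rewrite derive1E.
Qed.

(** The gradient is carried as data, so that the closure lemmas below compute the gradient of a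
    composite field by unification. *)
Definition has_grad (f : V -> R) (g : 'I_3 -> V -> R) :=
  [/\ cont f, (forall i, cont (g i)) &
      forall x i, unit_cball x -> is_derive x (basis i) f (g i x)].

Lemma dot_line (c : V) i (s : R) : c 0 i = 0 ->
  dot (c + s *: basis i) (c + s *: basis i) = dot c c + s ^+ 2.
Proof.
move=> ci; rewrite /dot [LHS](bigD1 i)//= [in RHS](bigD1 i)//= !mxE eqxx ci /=.
rewrite eqxx mulr1 !add0r mulr0 add0r addrC -expr2; congr (_ + _).
by apply: eq_bigr => j ji; rewrite !mxE (negbTE ji) andbF /= mulr0 addr0.
Qed.

Lemma slice_integral0 (G : V -> R) g i (c : V) :
  has_grad G g -> (forall x, unit_sphere x -> G x = 0) -> c 0 i = 0 ->
  \int[leb]_s (if `[<unit_ball (c + s *: basis i)>] then g i (c + s *: basis i) else 0) = 0.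
(* The line either misses the open ball or meets it in a chord [-r < s < r] whose endpoints lie on
   the sphere, where [G] vanishes; the fundamental theorem of calculus does the rest. *)
Proof.
move=> [cG cg dG] G0 ci; have [c1|c1] := ltP (dot c c) 1; last first.
  rewrite (_ : (fun s => _) = cst 0).
    by rewrite Rintegral_cst// mul0r.
  apply/funext => s; case: asboolP => //; rewrite /unit_ball /= dot_line// => h.
  by have := sqr_ge0 s; lra.
pose r := Num.sqrt (1 - dot c c).
have r0 : 0 < r by rewrite sqrtr_gt0 subr_gt0.
have r2 : r ^+ 2 = 1 - dot c c by rewrite sqr_sqrtr// subr_ge0 ltW.
have inB s : - r <= s <= r -> unit_cball (c + s *: basis i).
  move=> sr; rewrite /unit_cball /= dot_line//.
  have : s ^+ 2 <= r ^+ 2.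
    by move: sr => /andP[sr1 sr2]; nra.
  by rewrite r2; lra.
transitivity (\int[leb]_(s in `]-r, r[) g i (c + s *: basis i)).
  rewrite [RHS]Rintegral_mkcond; apply: eq_Rintegral => s _.
  rewrite patchE mem_setE /= in_itv /= -ltr_norml.
  have -> : (`|s| < r) = `[< unit_ball (c + s *: basis i) >].
    apply/idP/asboolP; rewrite /unit_ball /= dot_line//.
      rewrite -(@ltr_pXn2r _ 2)// ?nnegrE ?ltW// real_normK ?num_real// r2; lra.
    move=> h; rewrite -(@ltr_pXn2r _ 2)// ?nnegrE ?ltW// real_normK ?num_real// r2; lra.
  by [].
have cf s : - r <= s <= r -> {for s, continuous (fun t : R => g i (c + t *: basis i))}.
  by move=> /inB h; apply: continuous_line; exact: cg.
have mf : measurable_fun `[-r, r]%classic (fun t : R => g i (c + t *: basis i)).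
  apply: subspace_continuous_measurable_fun => //.
  by apply: continuous_in_subspaceT => s; rewrite inE/= in_itv/= => /cf.
(* The open chord is replaced by the closed one, on which the fundamental theorem is stated. *)
rewrite /Rintegral -(@integral_itv_bndoo _ _ _ _ true false); last first.
  apply/measurable_EFinP; apply: measurable_funS mf => // z /=.
  by rewrite !in_itv/= => /andP[z1 z2]; rewrite !ltW.
have H : (\int[leb]_(s in `[(- r)%R, r]) (g i (c + s *: basis i))%:E =
    (G (c + r *: basis i) - G (c + (- r) *: basis i))%:E)%E.
  apply: (@FTC2_continuous (fun t => G (c + t *: basis i))).
  - lra.
  - exact: cf.
  - by move=> s /inB h; apply: continuous_line; exact: cG.
  - move=> s /andP[s1 s2]; apply: is_derive_line; apply: dG; apply: inB.
    by rewrite !ltW.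
by rewrite H /= !G0 ?subr0// /unit_sphere /= dot_line// ?sqrrN r2; lra.
Qed.

(** By Fubini with the [i]-th variable innermost, every inner integral is a chord integral as in
    [slice_integral0]. *)
Lemma integral_partial0 (G : V -> R) g i :
  has_grad G g -> (forall x, unit_sphere x -> G x = 0) ->
  integral3 unit_ball (g i) = 0.
Proof.
move=> hG G0; have [_ cg _] := hG.
have bg := cont_bsupp (cg i).
have f1 : finite_set_measure leb (`[-1, 1]%classic : set (measurableTypeR R)) := finite_itv _ _.
have f2 := finite_set_measureX f1 f1.
have extif p : ext (g i) p = if `[<unit_ball (coords p)>] then g i (coords p) else 0.
  by case: asboolP => h; [rewrite extE|rewrite ext0].
rewrite integral3E.
elim/ord3P: i bg extif => bg extif.
- rewrite (Rintegral_fubini2 f2 f1 bg) (_ : (fun z => _) = cst 0) ?Rintegral_cst ?mul0r//.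
  apply/funext => z.
  rewrite (Rintegral_fubini2 f1 f1 (bsupp_section2 bg z)) (_ : (fun y => _) = cst 0) ?Rintegral_cst ?mul0r//.
  apply/funext => y /=.
  rewrite -[RHS](@slice_integral0 G g 0 (coords (0, y, z)) hG G0) ?coordsE//.
  apply: eq_Rintegral => x _; rewrite extif.
  rewrite (_ : coords (0, y, z) + x *: basis 0 = coords (x, y, z))//.
  apply/rowP; elim/ord3P; rewrite !mxE /=; lra.
- rewrite (Rintegral_fubini2 f2 f1 bg) (_ : (fun z => _) = cst 0) ?Rintegral_cst ?mul0r//.
  apply/funext => z.
  rewrite (Rintegral_fubini1 f1 f1 (bsupp_section2 bg z)) (_ : (fun y => _) = cst 0) ?Rintegral_cst ?mul0r//.
  apply/funext => x /=.
  rewrite -[RHS](@slice_integral0 G g 1 (coords (x, 0, z)) hG G0) ?coordsE//.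
  apply: eq_Rintegral => y _; rewrite extif.
  rewrite (_ : coords (x, 0, z) + y *: basis 1 = coords (x, y, z))//.
  apply/rowP; elim/ord3P; rewrite !mxE /=; lra.
- rewrite (Rintegral_fubini1 f2 f1 bg) (_ : (fun z => _) = cst 0) ?Rintegral_cst ?mul0r//.
  apply/funext => -[x y] /=.
  rewrite -[RHS](@slice_integral0 G g 2 (coords (x, y, 0)) hG G0) ?coordsE//.
  apply: eq_Rintegral => z _; rewrite extif.
  rewrite (_ : coords (x, y, 0) + z *: basis 2 = coords (x, y, z))//.
  apply/rowP; elim/ord3P; rewrite !mxE /=; lra.
Qed.

Lemma contD f g : cont f -> cont g -> cont (fun x : V => f x + g x).
Proof. by move=> cf cg x xB; apply: continuousD; [exact: cf|exact: cg]. Qed.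

Lemma contM f g : cont f -> cont g -> cont (fun x : V => f x * g x).
Proof. by move=> cf cg x xB; apply: continuousM; [exact: cf|exact: cg]. Qed.

Lemma cont_cst (c : R) : cont (fun _ : V => c).
Proof. by move=> x _; exact: cst_continuous. Qed.

Lemma cont_coord i : cont (fun x : V => x 0 i).
Proof. by move=> x _; exact: coord_cont. Qed.

Lemma has_gradD f f' g g' : has_grad f f' -> has_grad g g' ->
  has_grad (fun x => f x + g x) (fun i x => f' i x + g' i x).
Proof.
move=> [cf cf' df] [cg cg' dg]; split.
- exact: contD.
- by move=> i; exact: contD.
- by move=> x i xB; apply: is_deriveD; [exact: df|exact: dg].
Qed.

Lemma has_gradM f f' g g' : has_grad f f' -> has_grad g g' ->
  has_grad (fun x => f x * g x) (fun i x => f' i x * g x + f x * g' i x).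
Proof.
move=> [cf cf' df] [cg cg' dg]; split.
- exact: contM.
- by move=> i; apply: contD; exact: contM.
- move=> x i xB; have := df x i xB; have := dg x i xB => hg hf.
  apply: is_derive_eq (is_deriveM hf hg) _.
  by rewrite addrC /GRing.scale /= mulrC.
Qed.

Lemma has_grad_cst (c : R) : has_grad (fun _ => c) (fun _ _ => 0).
Proof.
split; [exact: cont_cst|move=> i; exact: cont_cst|].
move=> x i _; exact: is_derive_cst.
Qed.

Lemma is_derive_coord (x v : V) j : is_derive x v (fun y : V => y 0 j) (v 0 j).
Proof.
have E : (fun h : R => h^-1 *: (((fun y : V => y 0 j) \o shift x) (h *: v) - x 0 j))
       @ 0^' --> (v 0 j : R).
  apply: (@cvg_trans _ ((fun=> v 0 j : R) @ 0^')); last exact: cvg_cst.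
  apply: near_eq_cvg; near=> h.
  rewrite /= !mxE addrK /GRing.scale /= mulrA mulVf ?mul1r//.
  near: h; exact: nbhs_dnbhs_neq.
split; first by apply/cvg_ex; exists (v 0 j).
exact: cvg_lim E.
Unshelve. all: by end_near.
Qed.

Lemma has_grad_coord j : has_grad (fun x => x 0 j) (fun i _ => (i == j)%:R).
Proof.
split; [exact: cont_coord|move=> i; exact: cont_cst|] => x i _.
by apply: is_derive_eq (is_derive_coord x (basis i) j) _; rewrite mxE eqxx eq_sym.
Qed.

Lemma has_grad_eq f f' g g' : has_grad f f' -> f =1 g -> f' =2 g' -> has_grad g g'.
Proof.
move=> + /funext <- fg; rewrite (_ : g' = f')//.
by apply/funext => i; apply/funext => x; rewrite fg.
Qed.

Lemma has_grad_sum (f : 'I_3 -> V -> R) f' :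
  (forall k, has_grad (f k) (f' k)) ->
  has_grad (fun x => \sum_k f k x) (fun i x => \sum_k f' k i x).
Proof.
move=> h; apply: has_grad_eq (has_gradD (has_gradD (h 0) (h 1)) (h 2)) _ _.
  by move=> x; rewrite sum3.
by move=> i x; rewrite sum3.
Qed.

Lemma cont_sum n (f : 'I_n -> V -> R) :
  (forall k, cont (f k)) -> cont (fun x => \sum_k f k x).
Proof.
elim: n f => [f _|n IH f h].
  rewrite (_ : (fun x => _) = fun=> 0); first exact: cont_cst.
  by apply/funext => x; rewrite big_ord0.
rewrite (_ : (fun x => _) = fun x => f ord0 x + \sum_(k < n) f (lift ord0 k) x).
  by apply: contD; [exact: h|apply: IH => k; exact: h].
by apply/funext => x; rewrite big_ord_recl.
Qed.

End Gradient.

(** * Divergence theorem for tangential fields *)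

Section Divergence.
Context {R : realType}.
Local Notation V := 'rV[R]_3.
Local Notation Int := (integral3 (@unit_ball R)).

Lemma contN (f : V -> R) : cont f -> cont (fun x => - f x).
Proof. by move=> cf x xB; apply: continuousN; exact: cf. Qed.

Lemma contX n (f : V -> R) : cont f -> cont (fun x => f x ^+ n).
Proof.
move=> cf; elim: n => [|n IH].
  rewrite (_ : (fun x => _) = fun=> 1); first exact: cont_cst.
  by apply/funext => x; rewrite expr0.
rewrite (_ : (fun x => _) = fun x => f x * f x ^+ n); first exact: contM.
by apply/funext => x; rewrite exprS.
Qed.

Lemma contB (f g : V -> R) : cont f -> cont g -> cont (fun x => f x - g x).
Proof. by move=> cf cg; apply: contD => //; exact: contN. Qed.

Lemma cont_dot : cont (fun x : V => dot x x).
Proof. by move=> x _; exact: dot_cont. Qed.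

Lemma has_gradX n (f : V -> R) f' : has_grad f f' ->
  has_grad (fun x => f x ^+ n) (fun i x => n%:R * f x ^+ n.-1 * f' i x).
Proof.
move=> hf; elim: n => [|n IH].
  by apply: has_grad_eq (has_grad_cst 1) _ _ => // i x; rewrite !mul0r.
apply: has_grad_eq (has_gradM hf IH) _ _ => [x|i x]; first by rewrite exprS.
by case: n {IH} => [|n] /=; rewrite ?expr0 ?exprS -?natr1; ring.
Qed.

Lemma has_gradN (f : V -> R) f' : has_grad f f' ->
  has_grad (fun x => - f x) (fun i x => - f' i x).
Proof.
move=> [cf cf' df]; split; [exact: contN|by move=> i; exact: contN|].
by move=> x i xB; apply: is_deriveN; exact: df.
Qed.

Lemma has_gradB (f g : V -> R) f' g' : has_grad f f' -> has_grad g g' ->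
  has_grad (fun x => f x - g x) (fun i x => f' i x - g' i x).
Proof. by move=> hf hg; apply: has_gradD => //; exact: has_gradN. Qed.

Lemma has_grad_dot : has_grad (fun x : V => dot x x) (fun i x => 2 * x 0 i).
Proof.
have h k := has_gradM (@has_grad_coord R k) (@has_grad_coord R k).
apply: has_grad_eq (has_grad_sum h) _ _ => //= i x.
by rewrite sum3; elim/ord3P: i => /=; ring.
Qed.

Lemma Int_sum n (f : 'I_n -> V -> R) : (forall i, cont (f i)) ->
  Int (fun x => \sum_i f i x) = \sum_i Int (f i).
Proof.
elim: n f => [f _|n IH f cf].
  rewrite big_ord0 (integral3_eq (g := fun=> 0 * 0)).
    by rewrite integral3Z ?mul0r//; exact: cont_cst.
  by move=> x _; rewrite big_ord0 mul0r.
rewrite big_ord_recl -IH// -integral3D//; last exact: cont_sum.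
by apply: integral3_eq => x _; rewrite big_ord_recl.
Qed.

Lemma Int_div0 (G : 'I_3 -> V -> R) G' : (forall i, has_grad (G i) (G' i)) ->
  (forall i x, unit_sphere x -> G i x = 0) ->
  Int (fun x => \sum_i G' i i x) = 0.
Proof.
move=> hG G0; rewrite Int_sum => [|i]; last by case: (hG i).
by rewrite big1// => i _; apply: integral_partial0 (hG i) (G0 i).
Qed.

Local Notation q := (fun x : V => dot x x).

Lemma Int_lin2 a b (f g : V -> R) : cont f -> cont g ->
  Int (fun x => a * f x + b * g x) = a * Int f + b * Int g.
Proof.
move=> cf cg; rewrite integral3D ?integral3Z//; apply: contM => //; exact: cont_cst.
Qed.

(** Divergence theorem for the field q^k g x, which vanishes on the sphere; the factor 2k + 3 is the
    one in div (q^k x) = (2k + 3) q^k. *)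
Lemma Int_dotX_vanish k (g : V -> R) g' : has_grad g g' ->
  (forall x, unit_sphere x -> g x = 0) ->
  (2 * k + 3)%:R * Int (fun x => q x ^+ k * g x) =
  - Int (fun x => q x ^+ k * \sum_i x 0 i * g' i x).
Proof.
move=> hg g0; have [cg cg' _] := hg.
have H i := has_gradM (has_gradM (has_gradX k has_grad_dot) hg) (@has_grad_coord R i).
have h := Int_div0 H; move: h => /(_ _)/wrap[].
  by move=> i x xS; rewrite g0// mulr0 mul0r.
have c1 : cont (fun x => q x ^+ k * g x).
  by apply: contM => //; apply: contX; exact: cont_dot.
have c2 : cont (fun x => q x ^+ k * \sum_i x 0 i * g' i x).
  apply: contM; first by apply: contX; exact: cont_dot.
  by apply: cont_sum => i; apply: contM => //; exact: cont_coord.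
rewrite (integral3_eq (g := fun x => (2 * k + 3)%:R * (q x ^+ k * g x) +
    1 * (q x ^+ k * \sum_i x 0 i * g' i x))).
  by rewrite Int_lin2// => h; apply/eqP; rewrite -addr_eq0 -{2}h mul1r.
move=> x _; rewrite !sum3 !eqxx natrD natrM dot3E.
by case: k {H c1 c2} => [|k]; rewrite ?expr0 ?exprS /= -?natr1; ring.
Qed.

(** Divergence theorem for (1 - q^k) x, whose divergence is 3 - (2k + 3) q^k. *)
Lemma Int_dotX k : (2 * k + 3)%:R * Int (fun x => q x ^+ k) = 3 * Int (fun=> 1).
Proof.
have H i := has_gradM (has_gradB (has_grad_cst 1) (has_gradX k has_grad_dot)) (@has_grad_coord R i).
have h := Int_div0 H; move: h => /(_ _)/wrap[].
  by move=> i x ->; rewrite expr1n subrr mul0r.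
have c1 : cont (fun x => q x ^+ k) by apply: contX; exact: cont_dot.
rewrite (integral3_eq (g := fun x => 3 * 1 + (- (2 * k + 3)%:R) * q x ^+ k)).
  rewrite Int_lin2//; last exact: cont_cst.
  by rewrite mulNr => /eqP; rewrite subr_eq0 => /eqP.
move=> x _; rewrite !sum3 !eqxx natrD natrM dot3E.
by case: k {H c1} => [|k]; rewrite ?expr0 ?exprS /= -?natr1; ring.
Qed.

Lemma Int_abs_le (f g : V -> R) : cont f -> cont g ->
  (forall x, unit_ball x -> `|f x| <= g x) -> `|Int f| <= Int g.
Proof.
move=> cf cg fg; rewrite ler_norml; apply/andP; split.
  rewrite -mulN1r -integral3Z//; apply: integral3_le => //.
    by apply: contM => //; exact: cont_cst.
  by move=> x /fg; rewrite mulN1r ler_norml => /andP[].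
by apply: integral3_le => // x /fg; rewrite ler_norml => /andP[].
Qed.

(** The powers q^k concentrate near the sphere and have integral 3 vol / (2k + 3), so against a
    bounded [h] they decay like 1/k. *)
Lemma Int_dotX_bound (h : V -> R) : cont h -> exists2 M, 0 <= M & forall k,
  (2 * k + 3)%:R * `|Int (fun x => q x ^+ k * h x)| <= M.
Proof.
move=> ch; have [M M0 hM] := cont_bounded ch.
have cq k : cont (fun x => q x ^+ k) by apply: contX; exact: cont_dot.
exists (M * (3 * Int (fun=> 1))).
  apply: mulr_ge0 => //; rewrite -(Int_dotX 0) mulr_ge0//.
  rewrite -[leLHS](mul0r (Int (fun x => q x ^+ 0))) -integral3Z//.
  apply: integral3_le => //; first by apply: contM => //; exact: cont_cst.
  by move=> x _; rewrite mul0r expr0.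
move=> k; rewrite -(Int_dotX k) mulrCA ler_wpM2l// -integral3Z//.
apply: Int_abs_le.
- by apply: contM.
- by apply: contM => //; exact: cont_cst.
move=> x xB; rewrite normrM mulrC ler_pM ?normr_ge0//; first by apply: hM; exact: unit_ballW.
by rewrite ger0_norm// exprn_ge0// dot_ge0.
Qed.

(* With [g = F . x] vanishing on the sphere, testing against the cutoffs [1 - |x|^(2k+2)]
   and integrating by parts twice bounds the integral of [div F] by [O(1/k)], so that
   no surface integral is needed. *)
Lemma Int_div_tangential0 (F : 'I_3 -> V -> R) F' : (forall i, has_grad (F i) (F' i)) ->
  (forall x, unit_sphere x -> \sum_i F i x * x 0 i = 0) ->
  Int (fun x => \sum_i F' i i x) = 0.
Proof.
move=> hF F0.
have hg := has_grad_sum (fun i => has_gradM (hF i) (@has_grad_coord R i)).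
set g := (fun x => \sum_k F k x * x 0 k) in hg F0.
set g' := (fun i x => _) in hg.
have [cg cg' _] := hg.
pose d (x : V) := \sum_i F' i i x.
pose r (x : V) := \sum_i x 0 i * g' i x.
have cd : cont d by apply: cont_sum => i; case: (hF i).
have cr : cont r.
  by apply: cont_sum => i; apply: contM; [exact: cont_coord|exact: cg'].
have cq k : cont (fun x => q x ^+ k) by apply: contX; exact: cont_dot.
have [M M0 dM] := Int_dotX_bound cd.
have [N N0 rN] := Int_dotX_bound cr.
(* The field (1 - q^(k+1)) F vanishes on the sphere and has divergence (1 - q^(k+1)) d - 2 (k+1) q^k
   g. *)
have split k : Int d = Int (fun x => q x ^+ k.+1 * d x) + (2 * k.+1)%:R * Int (fun x => q x ^+ k * g x).
  have H i := has_gradM (has_gradB (has_grad_cst 1) (has_gradX k.+1 has_grad_dot)) (hF i).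
  have h := Int_div0 H; move: h => /(_ _)/wrap[].
    by move=> i x ->; rewrite expr1n subrr mul0r.
  have c1 : cont (fun x => q x ^+ k.+1 * d x) by exact: contM.
  have c2 : cont (fun x => q x ^+ k * g x) by exact: contM.
  rewrite (integral3_eq (g := fun x => 1 * d x + (-1) * (1 * (q x ^+ k.+1 * d x) +
     (2 * k.+1)%:R * (q x ^+ k * g x)))).
    rewrite Int_lin2//; last by apply: contD; apply: contM => //; exact: cont_cst.
    by rewrite Int_lin2// => h; lra.
  by move=> x _; rewrite /d /g !sum3 natrM /=; ring.
(* The first term of [split] is O(1/k) by [dM]. In the second, [Int_dotX_vanish] trades the factor
   2k + 3 for the radial derivative [r], and the remaining factor 2 (k+1) is absorbed by [rN]. *)
have bnd k : (2 * k + 3)%:R * `|Int d| <= M + N.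
  have p0 : (0 : R) < (2 * k + 3)%:R by rewrite ltr0n addn_gt0 orbT.
  have Hg := Int_dotX_vanish k hg F0; rewrite -/g in Hg.
  rewrite (split k) (le_trans (ler_wpM2l (ltW p0) (ler_normD _ _)))// mulrDr lerD//.
    apply: le_trans (dM k.+1); rewrite ler_wpM2r// ler_nat; lia.
  rewrite normrM mulrCA -[(2 * k + 3)%:R]ger0_norm; last exact: ltW.
  rewrite -normrM Hg normrN.
  apply: le_trans (rN k); rewrite ger0_norm// ler_wpM2r// ler_nat; lia.
apply/eqP/negPn/negP => d0.
have d1 : 0 < `|Int d| by rewrite normr_gt0.
(* By the Archimedean property some [k] makes 2k + 3 exceed (M + N) / |Int d|. *)
have := bnd (Num.truncn ((M + N) / `|Int d|)).
apply/negP; rewrite -ltNge -ltr_pdivrMr//.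
apply: lt_le_trans (truncnS_gt _) _; rewrite ler_nat.
by move: (Num.truncn _) => t; lia.
Qed.

Definition vol : R := Int (fun=> 1).

(** The cube [0, 1/2]^3 lies in the ball, since 3/4 < 1. *)
Lemma vol_gt0 : 0 < vol.
Proof.
pose J : set (measurableTypeR R) := `[0, 1/2]%classic.
have fJ : finite_set_measure (@lebesgue_measure R) J := finite_itv _ _.
have [mJ _] := fJ.
have fC := finite_set_measureX (finite_set_measureX fJ fJ) fJ.
set C := (J `*` J) `*` J in fC; have [mC _] := fC.
pose mu := (sfprod (sfprod (@lebesgue_measure R) (@lebesgue_measure R)) (@lebesgue_measure R)).
have leJ : lebesgue_measure J = (1 / 2)%:E :> \bar R.
  by rewrite /J lebesgue_measure_itv/= lte_fin ifT; [rewrite -EFinB subr0|lra].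
have muC : fine (mu C) = (1/2) * (1/2) * (1/2) :> R.
  have -> : mu C = (lebesgue_measure J * lebesgue_measure J * lebesgue_measure J)%E.
    apply: etrans (sfprodE _ _ (measurableX mJ mJ) mJ) _; congr (_ * _)%E.
    exact: (sfprodE _ _ mJ mJ).
  by rewrite leJ.
suff : (1/2) * (1/2) * (1/2) <= vol by lra.
have cm : measurable_fun setT ((cst 1 : _ -> R) \_ C).
  by apply/(measurable_restrictT _ mC); exact: measurable_cst.
rewrite -muC -[fine _]mul1r -(Rintegral_cst mu mC 1) Rintegral_mkcond /vol integral3E.
apply: le_Rintegral => //.
- apply: (bsupp_integrable fC); split => //.
  + by exists 1 => x; rewrite patchE; case: ifP => _; rewrite ?normr1// normr0.
  + by move=> x xC; rewrite patchE memNset.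
- exact: (cont_integrable (@cont_cst R 1)).
move=> [[x y] z] _; rewrite patchE; case: ifPn => [|_]; last first.
  have [xB|xB] := pselect (unit_ball (coords (x, y, z))); first by rewrite extE.
  by rewrite ext0.
rewrite inE => -[[/=]]; rewrite /J /= !in_itv /= => /andP[x0 x1] /andP[y0 y1] /andP[z0 z1].
rewrite extE// /unit_ball /= dot3E !coordsE /=; nra.
Qed.

(** The test function 1 - |x|^2 vanishes on the sphere and has [i]-th derivative -2 x_i. *)
Lemma Int_coord i : Int (fun x => x 0 i) = 0.
Proof.
have h := integral_partial0 i (has_gradB (has_grad_cst 1) has_grad_dot).
move: h => /(_ _)/wrap[]; first by move=> x ->; rewrite subrr.
rewrite (integral3_eq (g := fun x => (- 2) * x 0 i)) => [|x _]; last by ring.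
by rewrite integral3Z; [lra|exact: cont_coord].
Qed.

(** The test function is (1 - |x|^2) x_j; the fifth comes from int |x|^2 = 3/5 vol, which is
    [Int_dotX 1]. *)
Lemma Int_coordM i j : Int (fun x => x 0 i * x 0 j) = (i == j)%:R * (vol / 5).
Proof.
have h := integral_partial0 i (has_gradM (has_gradB (has_grad_cst 1) has_grad_dot)
  (@has_grad_coord R j)).
move: h => /(_ _)/wrap[]; first by move=> x ->; rewrite subrr mul0r.
have cq := cont_dot; have c1 := @cont_cst R 1.
have c3 : cont (fun x : V => x 0 i * x 0 j) by apply: contM; exact: cont_coord.
rewrite (integral3_eq (g := fun x => 1 * ((i == j)%:R * 1 + (- (i == j)%:R) * q x) +
   (- 2) * (x 0 i * x 0 j))) => [|x _]; last by ring.
rewrite Int_lin2//; last by apply: contD; apply: contM => //; exact: cont_cst.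
rewrite Int_lin2//.
have := Int_dotX 1; rewrite -/vol.
rewrite (integral3_eq (g := q)) => [|x _]; last by rewrite expr1.
by case: (i == j) => /= hq h; lra.
Qed.

End Divergence.

(** * Korn-Poincare inequality *)

Section Segment.
Context {R : realType}.
Local Notation leb := (@lebesgue_measure R).
Local Notation T3 := (measurableTypeR R * measurableTypeR R * measurableTypeR R)%type.
Local Notation V := 'rV[R]_3.
Local Notation mu2 := (sfprod leb leb).
Local Notation mu3 := (sfprod mu2 leb).
Local Notation Int := (integral3 (@unit_ball R)).

(* [w' i j] is the [j]-th partial derivative of the component [w i]. *)
Definition c1_field (w : 'I_3 -> V -> R) (w' : 'I_3 -> 'I_3 -> V -> R) :=
  (forall i, has_grad (w i) (w' i)) /\
  (forall i x, unit_cball x -> differentiable (w i) x).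

Definition strain2 (w' : 'I_3 -> 'I_3 -> V -> R) (x : V) : R :=
  \sum_i \sum_j (w' i j x + w' j i x) ^+ 2.

Lemma sum_basis (d : V) : d = \sum_j d 0 j *: Defs.basis j.
Proof. exact: row_sum_delta. Qed.

(** Here [c1_field] has to give more than partial derivatives: the segments used below are not
    parallel to the axes. *)
Lemma c1_is_derive w w' i x d : c1_field w w' -> unit_cball x ->
  is_derive x d (w i) (\sum_j d 0 j * w' i j x).
Proof.
move=> [hw dw] xB; have df := dw i x xB; split; first exact: diff_derivable.
rewrite deriveE// {1}[d]sum_basis linear_sum; apply: eq_bigr => j _.
rewrite linearZ /= -deriveE//; congr (_ * _).
by case: (hw i) => _ _ /(_ x j xB) [].
Qed.

Lemma convex_unit_ball (x d : V) s : unit_ball x -> unit_ball (x + d) ->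
  0 <= s <= 1 -> unit_ball (x + s *: d).
Proof.
rewrite /unit_ball /= !dot3E !mxE => h1 h2 /andP[s0 s1].
(* The strict inequality will come from the endpoint [x + d], which has weight [s]; hence [s = 0] is
   treated apart. *)
have [->|s10] := eqVneq s 0; first by rewrite !mul0r !addr0.
have sp : 0 < s by rewrite lt0r s10.
set a := x 0 0 in h1 h2 *; set b := x 0 1 in h1 h2 *; set c := x 0 2 in h1 h2 *.
set a' := d 0 0 in h2 *; set b' := d 0 1 in h2 *; set c' := d 0 2 in h2 *.
have E : (a + s * a') * (a + s * a') + (b + s * b') * (b + s * b') + (c + s * c') * (c + s * c')
  = (1 - s) * (a * a + b * b + c * c)
  + s * ((a + a') * (a + a') + (b + b') * (b + b') + (c + c') * (c + c'))
  - s * (1 - s) * (a' ^+ 2 + b' ^+ 2 + c' ^+ 2) by ring.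
have n0 : 0 <= s * (1 - s) * (a' ^+ 2 + b' ^+ 2 + c' ^+ 2).
  by rewrite !mulr_ge0 ?subr_ge0 ?addr_ge0 ?sqr_ge0// ltW.
have t1 : (1 - s) * (a * a + b * b + c * c) <= 1 - s.
  by rewrite -[leRHS]mulr1 ler_wpM2l ?subr_ge0// ltW.
have t2 : s * ((a + a') * (a + a') + (b + b') * (b + b') + (c + c') * (c + c')) < s.
  by rewrite -[ltRHS]mulr1 ltr_pM2l.
by rewrite E; lra.
Qed.

Lemma sqr_sum3_le (a : 'I_3 -> R) : (\sum_i a i) ^+ 2 <= 3 * \sum_i a i ^+ 2.
Proof.
rewrite !sum3; have := sqr_ge0 (a 0 - a 1); have := sqr_ge0 (a 0 - a 2); have := sqr_ge0 (a 1 - a 2).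
by nra.
Qed.

(** The quadratic form of the gradient in the direction [d] sees only its symmetric part. The
    constant is 36 = 1/4 * 3 * 3 * 16: the halved strain squared, Cauchy-Schwarz on each of the two
    sums, and (d_i d_j)^2 <= 16 for a difference [d] of two points of the ball. *)
Lemma strain_form_le w' (x d : V) : (forall i, `|d 0 i| <= 2) ->
  (\sum_i d 0 i * \sum_j d 0 j * w' i j x) ^+ 2 <= 36 * strain2 w' x.
Proof.
move=> d2.
have -> : \sum_i d 0 i * (\sum_j d 0 j * w' i j x) =
    2^-1 * \sum_i \sum_j d 0 i * d 0 j * (w' i j x + w' j i x).
  by rewrite !sum3; field.
rewrite exprMn (_ : 36 * _ = (2^-1) ^+ 2 * (9 * (16 * strain2 w' x))); last by field.
rewrite ler_wpM2l ?sqr_ge0//.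
apply: le_trans (sqr_sum3_le _) _.
rewrite (_ : 9 * (16 * strain2 w' x) = 3 * \sum_i (3 * (\sum_j 16 * (w' i j x + w' j i x) ^+ 2))); last first.
  by rewrite /strain2 !sum3; ring.
rewrite ler_wpM2l//; apply: ler_sum => i _.
apply: le_trans (sqr_sum3_le _) _; rewrite ler_wpM2l//; apply: ler_sum => j _.
rewrite exprMn ler_wpM2r ?sqr_ge0// exprMn.
have e k : d 0 k ^+ 2 <= 4.
  by have := d2 k; rewrite ler_norml => /andP[]; nra.
rewrite (_ : 16 = 4 * 4); last by ring.
by apply: ler_pM; rewrite ?sqr_ge0.
Qed.

Lemma integrable_continuous01 (g : R -> R) :
  (forall s : R, 0 <= s <= 1 -> {for s, continuous g}) ->
  leb.-integrable `[0, 1]%classic (EFin \o g).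
Proof.
move=> cg; apply: continuous_compact_integrable; first exact: segment_compact.
by apply: continuous_in_subspaceT => s; rewrite inE/= in_itv/= => /cg.
Qed.

Lemma continuous_sqr (g : R -> R) (s : R) :
  {for s, continuous g} -> {for s, continuous (fun t => g t ^+ 2)}.
Proof.
move=> cg; rewrite (_ : (fun t => g t ^+ 2) = g * g); first exact: continuousM.
by apply/funext => t; rewrite expr2.
Qed.

(** Expand the nonnegative integral of [(f s - c) ^+ 2], where [c = F 1 - F 0] is the mean of
    [f]. *)
Lemma Jensen01 (F f : R -> R) :
  (forall s : R, 0 <= s <= 1 -> {for s, continuous f}) ->
  (forall s : R, 0 <= s <= 1 -> is_derive s 1 F (f s)) ->
  (F 1 - F 0) ^+ 2 <= \int[leb]_(s in `[0, 1]) (f s ^+ 2).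
Proof.
move=> cf dF; set c := F 1 - F 0.
have cF (s : R) : 0 <= s <= 1 -> {for s, continuous F}.
  by move=> /dF [/derivable1_diffP/differentiable_continuous].
have cint := integrable_continuous01.
have cf2 (s : R) : 0 <= s <= 1 -> {for s, continuous (fun t => f t ^+ 2)}.
  by move=> /cf; exact: continuous_sqr.
have := @FTC2_continuous R F f 0 1 ltr01 cf cF _ => /(_ _)/wrap[].
  by move=> s /andP[s0 s1]; apply: dF; rewrite !ltW.
move=> FTC.
have intf : \int[leb]_(s in `[0, 1]) f s = c by rewrite /Rintegral FTC.
have lb1 : fine (leb `[0, 1]%classic) = 1 :> R.
  by rewrite lebesgue_measure_itv/= lte_fin ltr01 -EFinB subr0.
have h0 : 0 <= \int[leb]_(s in `[0, 1]) (f s - c) ^+ 2.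
  by apply: Rintegral_ge0 => s _; exact: sqr_ge0.
have E : \int[leb]_(s in `[0, 1]) (f s - c) ^+ 2 =
   \int[leb]_(s in `[0, 1]) (f s ^+ 2) - c ^+ 2.
  transitivity (\int[leb]_(s in `[0, 1]) (f s ^+ 2 + ((- 2 * c) * f s + c ^+ 2))).
    by apply: eq_Rintegral => s _; ring.
  rewrite RintegralD//; [|exact: cint|apply: cint]; last first.
    move=> s /cf h; apply: continuousD; last exact: cst_continuous.
    by apply: continuousM => //; exact: cst_continuous.
  rewrite RintegralD//; [|apply: cint|apply: cint].
  - rewrite RintegralZl// ?intf; last exact: cint.
    by rewrite Rintegral_cst// lb1; ring.
  - by move=> s /cf h; apply: continuousM => //; exact: cst_continuous.
  - by move=> s _; exact: cst_continuous.
by rewrite E subr_ge0 in h0.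
Qed.

(** It vanishes identically for rigid motions, which is why the strain alone can bound it. *)
Definition pair_diff (w : 'I_3 -> V -> R) (x y : V) : R :=
  \sum_i (w i y - w i x) * (y 0 i - x 0 i).

(** The function s -> d . w(x + s d) increases by [pair_diff] over [0, 1], and its derivative is the
    quadratic form of [strain_form_le]. *)
Lemma segment_pointwise w w' (x d : V) : c1_field w w' ->
  unit_ball x -> unit_ball (x + d) ->
  pair_diff w x (x + d) ^+ 2 <=
  36 * \int[leb]_(s in `[0, 1]) strain2 w' (x + s *: d).
Proof.
move=> cw xB xdB.
have d2 i : `|d 0 i| <= 2.
  have := unit_cball_coord i (unit_ballW xB); have := unit_cball_coord i (unit_ballW xdB).
  by rewrite mxE !ler_norml => /andP[? ?] /andP[? ?]; apply/andP; split; lra.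
have inB s : 0 <= s <= 1 -> unit_cball (x + s *: d).
  by move=> s01; apply/unit_ballW/convex_unit_ball.
have [hw dw] := cw.
pose Ft (y : V) := d 0 0 * w 0 y + d 0 1 * w 1 y + d 0 2 * w 2 y.
pose ft (y : V) := \sum_i d 0 i * \sum_j d 0 j * w' i j y.
have cwij i j : cont (w' i j) by case: (hw i).
have cft : cont ft.
  apply: cont_sum => i; apply: contM; first exact: cont_cst.
  by apply: cont_sum => j; apply: contM => //; exact: cont_cst.
have cs : cont (strain2 w').
  by apply: cont_sum => i; apply: cont_sum => j; apply: contX; exact: contD.
have dFt y : unit_cball y -> is_derive y d Ft (ft y).
  move=> yB; have h i := c1_is_derive i d cw yB.
  have := is_deriveD (is_deriveD (is_deriveZ (d 0 0) (h 0)) (is_deriveZ (d 0 1) (h 1)))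
    (is_deriveZ (d 0 2) (h 2)).
  by rewrite /ft [in X in _ -> X]sum3.
have J := @Jensen01 (fun s => Ft (x + s *: d)) (fun s => ft (x + s *: d)) _ _.
have {J} := J (fun s h => continuous_line (cft _ (inB s h))) (fun s h => is_derive_line (dFt _ (inB s h))).
have -> : Ft (x + 1 *: d) - Ft (x + 0 *: d) = pair_diff w x (x + d).
  by rewrite scale1r scale0r addr0 /Ft /pair_diff sum3 !mxE; ring.
move=> h; apply: le_trans h _.
have cs1 (s : R) : 0 <= s <= 1 -> {for s, continuous (fun t : R => strain2 w' (x + t *: d))}.
  by move=> /inB h; apply: continuous_line; exact: cs.
rewrite -RintegralZl//; last exact: integrable_continuous01.
apply: le_Rintegral => //.
- apply: integrable_continuous01 => s /inB h.
  by apply: continuous_sqr; apply: continuous_line; exact: cft.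
- apply: integrable_continuous01 => s /cs1 h.
  by apply: continuousM => //; exact: cst_continuous.
by move=> s _; exact: strain_form_le.
Qed.

Definition shift3 (c p : T3) : T3 := ((p.1.1 + c.1.1, p.1.2 + c.1.2), p.2 + c.2).

Lemma coords_shift3 c p : coords (shift3 c p) = coords p + coords c :> V.
Proof. by apply/rowP; elim/ord3P; rewrite !mxE. Qed.

Definition cube (r : R) : set T3 :=
  (`[- r, r]%classic `*` `[- r, r]%classic) `*` `[- r, r]%classic.

Lemma finite_cube r : finite_set_measure mu3 (cube r).
Proof.
have f1 := finite_itv (- r) r.
exact: finite_set_measureX (finite_set_measureX f1 f1) f1.
Qed.

Lemma cubeP r (p : T3) : (forall i, `|coords p 0 i| <= r) -> cube r p.
Proof.
move=> h; split; [split|]; rewrite /= in_itv /= -ler_norml.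
- by have := h 0; rewrite coordsE.
- by have := h 1; rewrite coordsE.
- by have := h 2; rewrite coordsE.
Qed.

Lemma measure_preserving_shift3 c : measure_preserving mu3 (shift3 c).
Proof.
have h := @measure_preserving_shift R.
exact: measure_preservingX (measure_preservingX (h c.1.1) (h c.1.2)) (h c.2).
Qed.

Lemma measurable_fst_fst : measurable_fun setT (fun p : T3 => p.1.1).
Proof. exact: measurableT_comp measurable_fst measurable_fst. Qed.

Lemma measurable_fst_snd : measurable_fun setT (fun p : T3 => p.1.2).
Proof. exact: measurableT_comp measurable_snd measurable_fst. Qed.

Lemma measurable_shift3 d (T : measurableType d) (f g : T -> T3) :
  measurable_fun setT f -> measurable_fun setT g ->
  measurable_fun setT (fun z => shift3 (f z) (g z)).
Proof.
move=> mf mg; apply: measurable_fun_pair; [apply: measurable_fun_pair|];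
  apply: measurable_funD.
- exact: measurableT_comp measurable_fst_fst mg.
- exact: measurableT_comp measurable_fst_fst mf.
- exact: measurableT_comp measurable_fst_snd mg.
- exact: measurableT_comp measurable_fst_snd mf.
- exact: measurableT_comp measurable_snd mg.
- exact: measurableT_comp measurable_snd mf.
Qed.

Definition scale3 (s : R) (p : T3) : T3 := ((s * p.1.1, s * p.1.2), s * p.2).

Lemma coords_scale3 s p : coords (scale3 s p) = s *: coords p :> V.
Proof. by apply/rowP; elim/ord3P; rewrite !mxE. Qed.

Lemma measurable_scale3 (d : T3) : measurable_fun setT (fun s : measurableTypeR R => scale3 s d).
Proof.
apply: measurable_fun_pair; [apply: measurable_fun_pair|]; exact: measurable_funM.
Qed.

Section SegmentBound.
Variables (w : 'I_3 -> V -> R) (w' : 'I_3 -> 'I_3 -> V -> R).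
Hypothesis cw : c1_field w w'.

Let cwi i : cont (w i). Proof. by case: cw => /(_ i) []. Qed.

Let cE : cont (strain2 w').
Proof.
case: cw => hw _; apply: cont_sum => i; apply: cont_sum => j; apply: contX.
by apply: contD; [case: (hw i)|case: (hw j)].
Qed.

Let E := ext (strain2 w').
Let one : T3 -> R := ext (fun=> 1).

(** Every factor goes through [ext], so that boundedness and measurability on all pairs are
    inherited; the factors [one] cut off pairs that leave the ball. *)
Let Psi (z : T3 * T3) : R := one z.1 * one z.2 *
  ((ext (w 0) z.2 - ext (w 0) z.1) * (ext (fun x => x 0 0) z.2 - ext (fun x => x 0 0) z.1) +
   (ext (w 1) z.2 - ext (w 1) z.1) * (ext (fun x => x 0 1) z.2 - ext (fun x => x 0 1) z.1) +
   (ext (w 2) z.2 - ext (w 2) z.1) * (ext (fun x => x 0 2) z.2 - ext (fun x => x 0 2) z.1)) ^+ 2.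

Let PsiE p y : unit_ball (coords p) -> unit_ball (coords y) ->
  Psi (p, y) = pair_diff w (coords p) (coords y) ^+ 2.
Proof.
by move=> pB yB; rewrite /Psi /one /= !extE// /pair_diff sum3 !mul1r.
Qed.

Let Psi0 p y : ~ (unit_ball (coords p) /\ unit_ball (coords y)) -> Psi (p, y) = 0.
Proof.
move=> h; rewrite /Psi /one /=.
have [pB|pB] := pselect (unit_ball (coords p)); last by rewrite (ext0 _ pB) !mul0r.
by rewrite (@ext0 _ _ y) ?mulr0 ?mul0r// => yB; exact: h.
Qed.

Let bounded_Psi : bsupp setT Psi.
Proof.
have b1 f : cont f -> bsupp setT (fun z : T3 * T3 => ext f z.1).
  by move=> /cont_bsupp/bsupp_bounded; exact: bsupp_comp measurable_fst.
have b2 f : cont f -> bsupp setT (fun z : T3 * T3 => ext f z.2).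
  by move=> /cont_bsupp/bsupp_bounded; exact: bsupp_comp measurable_snd.
have b12 f : cont f -> bsupp setT (fun z : T3 * T3 => ext f z.2 - ext f z.1).
  by move=> cf; apply: bsuppD; [exact: b2|apply: bsuppN; exact: b1].
have c1 : cont (fun=> 1 : R) := @cont_cst R 1.
have cc i := @cont_coord R i.
apply: bsuppM; first by apply: bsuppM; [exact: b1|exact: b2].
by apply: (bsuppM (f := fun z => _ + _ + _)); (apply: bsuppD; [apply: bsuppD|]);
  apply: bsuppM; exact: b12.
Qed.

Let Phi (z : T3 * T3) : R := Psi (z.1, shift3 z.1 z.2).

Let coords_cube1 p : unit_ball (coords p) -> cube 1 p.
Proof. by move=> pB; apply: cubeP => i; apply: unit_cball_coord; exact: unit_ballW. Qed.

Let bsupp_Phi : bsupp (cube 1 `*` cube 2) Phi.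
Proof.
have [m M _] : bsupp setT Phi.
  apply: (bsupp_comp (h := fun z : T3 * T3 => (z.1, shift3 z.1 z.2))) bounded_Psi.
  apply: measurable_fun_pair => //.
  exact: measurable_shift3.
split=> // -[p d] h; apply: Psi0 => -[pB dB]; apply: h; split; first exact: coords_cube1.
apply: cubeP => i; rewrite coords_shift3 /= in dB.
have := unit_cball_coord i (unit_ballW pB).
have := unit_cball_coord i (unit_ballW dB).
by rewrite mxE !ler_norml => /andP[? ?] /andP[? ?]; apply/andP; split; lra.
Qed.

Let I01 : set (measurableTypeR R) := `[0, 1]%classic.

(* [Psi (x, y)] is the squared pairing, [Phi (x, d)] its value at [y = x + d], and [H d (x, s)]
   the strain at the point [x + s d] of the segment. *)
Let H (d : T3) (z : T3 * measurableTypeR R) : R :=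
  (\1_I01 z.2) * E (shift3 (scale3 z.2 d) z.1).

(** If [x + s d] lies in the ball and [s] in [0, 1], then each coordinate of [x] is at most [rad d]
    in absolute value. Only its finiteness matters, as [d] is fixed in [H d]. *)
Let rad (d : T3) : R := 1 + (`|d.1.1| + `|d.1.2| + `|d.2|).

Let bsupp_H d : bsupp (cube (rad d) `*` I01) (H d).
Proof.
have mI : measurable_fun setT (\1_I01 : measurableTypeR R -> R).
  by apply: measurable_indic; case: (finite_itv (0 : R) 1).
have [m M _] : bsupp setT (H d).
  apply: bsuppM.
    split=> //; first exact: measurableT_comp mI measurable_snd.
      by exists 1 => z; rewrite indicE; case: (_ \in _); rewrite ?normr1// normr0.
    by move=> z [].
  apply: (bsupp_comp (f := E) (h := fun z : T3 * measurableTypeR R => shift3 (scale3 z.2 d) z.1)).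
    apply: measurable_shift3 => //.
    exact: measurableT_comp (measurable_scale3 d) measurable_snd.
  exact: bsupp_bounded (cont_bsupp cE).
split=> // -[p s] h; rewrite /H /=.
have [s01|s01] := pselect (I01 s); last by rewrite indicE memNset// mul0r.
have [pB|pB] := pselect (unit_ball (coords (shift3 (scale3 s d) p))); last first.
  by rewrite /E ext0// mulr0.
exfalso; apply: h; split => //; apply: cubeP => i /=.
have := unit_cball_coord i (unit_ballW pB).
rewrite coords_shift3 coords_scale3 (_ : (coords p + s *: coords d) 0 i =
  coords p 0 i + s * coords d 0 i); last by rewrite !mxE.
move: s01; rewrite /I01 /= in_itv /= => /andP[s0 s1] h.
have hd : `|coords d 0 i| <= `|d.1.1| + `|d.1.2| + `|d.2|.
  have := normr_ge0 d.1.1; have := normr_ge0 d.1.2; have := normr_ge0 d.2.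
  by elim/ord3P: i {h}; rewrite coordsE; lra.
rewrite -[coords p 0 i](addrK (s * coords d 0 i)) (le_trans (ler_normB _ _))// /rad.
apply: lerD => //; apply: le_trans hd.
by rewrite normrM ger0_norm// ler_piMl.
Qed.

Let finite01 : finite_set_measure leb I01.
Proof. exact: finite_itv. Qed.

Let leb01 : fine (leb I01) = 1.
Proof. by rewrite /I01 lebesgue_measure_itv/= lte_fin ltr01 -EFinB subr0. Qed.

Let Phi_le p d : Phi (p, d) <= 36 * \int[leb]_s H d (p, s).
Proof.
have E0 x : 0 <= strain2 w' x.
  by apply: sumr_ge0 => i _; apply: sumr_ge0 => j _; exact: sqr_ge0.
have [[pB dB]|h] := pselect (unit_ball (coords p) /\ unit_ball (coords (shift3 p d))); last first.
  rewrite /Phi /= Psi0// mulr_ge0//; apply: Rintegral_ge0 => s _.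
  rewrite /H /= mulr_ge0//.
  by rewrite /E /ext patchE; case: ifP => // _; exact: E0.
rewrite /Phi /= PsiE// coords_shift3 addrC.
rewrite coords_shift3 addrC in dB.
rewrite (le_trans (segment_pointwise cw pB dB))// ler_wpM2l//.
rewrite -/I01 Rintegral_mkcond le_eqVlt; apply/orP; left; apply/eqP.
apply: eq_Rintegral => s _; rewrite patchE /H /= indicE.
case: ifPn => [|_]; last by rewrite mul0r.
rewrite inE /I01 /= in_itv /= => s01; rewrite mul1r /E extE ?coords_shift3 ?coords_scale3 1?addrC//.
by rewrite addrC; exact: convex_unit_ball.
Qed.

(** For fixed [d] and [s] the map x -> x + s d is a translation, so after exchanging [x] and [s]
    each inner integral is the full integral of the strain extended by zero. This is the gain of
    using [d = y - x] as variable: the bound is uniform in [d], with no Jacobian. *)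
Let int_Phi_le d : \int[mu3]_p Phi (p, d) <= 36 * Int (strain2 w').
Proof.
have fc := finite_cube (rad d).
have bH := bsupp_H d.
apply: (@le_trans _ _ (\int[mu3]_p (36 * \int[leb]_s H d (p, s)))).
  apply: le_Rintegral => //.
  - exact: (bsupp_integrable (finite_cube 1) (bsupp_section2 bsupp_Phi d)).
  - apply: (bsupp_integrable fc); apply: bsuppZ; exact: (bsupp_Rint1 fc finite01 bH).
rewrite RintegralZl//; last exact: (bsupp_integrable fc (bsupp_Rint1 fc finite01 bH)).
rewrite ler_wpM2l// -(Rintegral_fubini1 fc finite01 bH) (Rintegral_fubini2 fc finite01 bH).
have mE : measurable_fun setT E by case: (cont_bsupp cE).
rewrite (@eq_Rintegral _ _ _ _ _ (((fun=> Int (strain2 w')) \_ I01))).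
  rewrite -Rintegral_mkcond Rintegral_cst//.
  by move: leb01; rewrite /= => ->; rewrite mulr1.
  by case: finite01.
move=> s _; rewrite patchE /H /=.
have bEs : bsupp setT (fun p => E (shift3 (scale3 s d) p)).
  exact: bsupp_comp (measure_preserving_shift3 _).1 (bsupp_bounded (cont_bsupp cE)).
case: ifPn => s01.
  rewrite integral3E -(Rintegral_preserving (measure_preserving_shift3 (scale3 s d)) mE).
  by apply: eq_Rintegral => p _; rewrite indicE s01 mul1r.
rewrite (@eq_Rintegral _ _ _ _ _ (fun=> 0)) ?Rintegral_cst ?mul0r// => p _.
by rewrite indicE (negbTE s01) mul0r.
Qed.

Lemma segment_bound :
  Int (fun x => Int (fun y => pair_diff w x y ^+ 2)) <=
  36 * fine (mu3 (cube 2)) * Int (strain2 w').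
Proof.
set S := fun x => Int _; rewrite integral3E.
rewrite (@eq_Rintegral _ _ _ _ _ (fun p => \int[mu3]_d Phi (p, d))); last first.
  move=> p _; transitivity (\int[mu3]_y Psi (p, y)); last first.
    have [mPsi _ _] := bounded_Psi.
    by rewrite /Phi /= (Rintegral_preserving (f := fun y => Psi (p, y)) (measure_preserving_shift3 p))//; exact: measurableT_comp.
  have [pB|pB] := pselect (unit_ball (coords p)); last first.
    rewrite (@ext0 _ S p pB) (@eq_Rintegral _ _ _ _ _ (fun=> 0)) ?Rintegral_cst ?mul0r// => y _.
    by rewrite Psi0// => -[].
  rewrite (@extE _ S p pB) /S integral3E.
  apply: eq_Rintegral => y _.
  have [yB|yB] := pselect (unit_ball (coords y)); first by rewrite (extE _ yB) PsiE.
  by rewrite (ext0 _ yB) Psi0// => -[].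
have f1 := finite_cube 1; have f2 := finite_cube 2.
rewrite -(Rintegral_fubini1 f1 f2 bsupp_Phi) (Rintegral_fubini2 f1 f2 bsupp_Phi).
rewrite mulrAC; apply: le_trans (ler_norm _) _.
apply: (bsupp_Rintegral_bound f2 (bsupp_Rint2 f1 f2 bsupp_Phi)) => d.
rewrite ger0_norm; first exact: int_Phi_le.
apply: Rintegral_ge0 => p _; rewrite /Phi /Psi mulr_ge0 ?sqr_ge0// mulr_ge0//.
  by rewrite /one /ext patchE; case: ifP.
by rewrite /one /ext patchE; case: ifP.
Qed.

End SegmentBound.

End Segment.

(** * Expansion of the double integral and its coercivity *)

Section KornPoincare.
Context {R : realType}.
Local Notation V := 'rV[R]_3.
Local Notation Int := (integral3 (@unit_ball R)).

(** The kernel has finite rank, so expanding its square separates the variables and leaves products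
    of single integrals. *)
Lemma Int_square_sum n (r s : 'I_n -> V -> R) :
  (forall k, cont (r k)) -> (forall k, cont (s k)) ->
  Int (fun x => Int (fun y => (\sum_k (r k x * s k y + s k x * r k y)) ^+ 2)) =
  2 * \sum_k \sum_l (Int (fun x => r k x * r l x) * Int (fun x => s k x * s l x) +
                     Int (fun x => r k x * s l x) * Int (fun x => s k x * r l x)).
Proof.
move=> cr cs.
have cM f g : cont f -> cont g -> cont (fun x : V => f x * g x) by exact: contM.
have cc (c : R) : cont (fun _ : V => c) := @cont_cst R c.
have lin4 a b c d (f g h k : V -> R) : cont f -> cont g -> cont h -> cont k ->
    Int (fun x => a * f x + b * g x + (c * h x + d * k x)) =
    a * Int f + b * Int g + (c * Int h + d * Int k).
  move=> cf cg ch ck; rewrite integral3D; last 2 first.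
  - by apply: contD; exact: cM.
  - by apply: contD; exact: cM.
  by rewrite !Int_lin2.
have c4 a b c d (f g h k : V -> R) : cont f -> cont g -> cont h -> cont k ->
    cont (fun x => a * f x + b * g x + (c * h x + d * k x)).
  by move=> cf cg ch ck; apply: contD; apply: contD; exact: cM.
pose RR k l := Int (fun x => r k x * r l x).
pose RS k l := Int (fun x => r k x * s l x).
pose SR k l := Int (fun x => s k x * r l x).
pose SS k l := Int (fun x => s k x * s l x).
have inner x : Int (fun y => (\sum_k (r k x * s k y + s k x * r k y)) ^+ 2) =
    \sum_k \sum_l (SS k l * (r k x * r l x) + SR k l * (r k x * s l x) +
                   (RS k l * (s k x * r l x) + RR k l * (s k x * s l x))).
  rewrite (integral3_eq (g := fun y => \sum_k \sum_l
    ((r k x * r l x) * (s k y * s l y) + (r k x * s l x) * (s k y * r l y) +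
     ((s k x * r l x) * (r k y * s l y) + (s k x * s l x) * (r k y * r l y))))); last first.
    by move=> y _; rewrite expr2 big_distrlr /=; apply: eq_bigr => k _; apply: eq_bigr => l _; ring.
  rewrite Int_sum => [|k]; last by apply: cont_sum => l; apply: c4; exact: cM.
  apply: eq_bigr => k _; rewrite Int_sum => [|l]; last by apply: c4; exact: cM.
  apply: eq_bigr => l _; rewrite lin4; [|exact: cM..].
  by rewrite /SS /SR /RS /RR; ring.
rewrite (integral3_eq (fun x _ => inner x)).
rewrite Int_sum => [|k]; last by apply: cont_sum => l; apply: c4; exact: cM.
rewrite big_distrr /=; apply: eq_bigr => k _; rewrite Int_sum => [|l]; last by apply: c4; exact: cM.
rewrite big_distrr /=; apply: eq_bigr => l _; rewrite lin4; [|exact: cM..].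
by rewrite /SS /SR /RS /RR; ring.
Qed.

Lemma Int_ge0 (f : V -> R) : cont f -> (forall x, unit_ball x -> 0 <= f x) -> 0 <= Int f.
Proof.
move=> cf f0; rewrite -(mul0r (Int f)) -integral3Z//; apply: integral3_le => //.
  by apply: contM => //; exact: cont_cst.
by move=> x /f0; rewrite mul0r.
Qed.

(** Cauchy-Schwarz against the constant 1, read off from the integral of [(vol * f x - a) ^+ 2]
    after division by [vol]. *)
Lemma Int_CS (f : V -> R) : cont f -> Int f ^+ 2 <= vol * Int (fun x => f x ^+ 2).
Proof.
move=> cf; have v0 := @vol_gt0 R; set a := Int f.
have cc (c : R) : cont (fun _ : V => c) := @cont_cst R c.
have := @Int_ge0 (fun x => (vol * f x - a) ^+ 2) _ (fun x _ => sqr_ge0 _) => /(_ _)/wrap[].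
  by apply: contX; apply: contB; [exact: contM|exact: cc].
rewrite (integral3_eq (g := fun x => 1 * (vol ^+ 2 * f x ^+ 2 + (- 2 * vol * a) * f x) + a ^+ 2 * 1)) => [|x _]; last by ring.
have c2 := @contX _ 2 _ cf.
rewrite Int_lin2//; last by apply: contD; exact: contM.
rewrite Int_lin2// -/vol -/a => h.
have {}h : 0 <= vol * (vol * Int (fun x => f x ^+ 2) - a ^+ 2).
  by move: h; rewrite (_ : 1 * _ + _ = vol * (vol * Int (fun x => f x ^+ 2) - a ^+ 2))//; ring.
by rewrite pmulr_rge0// subr_ge0 in h.
Qed.

Definition tangential (w : 'I_3 -> V -> R) :=
  forall x, unit_sphere x -> \sum_i w i x * x 0 i = 0.

Definition moment (w : 'I_3 -> V -> R) i j := Int (fun x => w i x * x 0 j).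

Definition sqn (w : 'I_3 -> V -> R) (x : V) : R := \sum_i w i x ^+ 2.

Lemma pair_diff_expand (w : 'I_3 -> V -> R) : (forall i, cont (w i)) ->
  Int (fun x => Int (fun y => pair_diff w x y ^+ 2)) =
  2 * (vol * Int (fun x => (\sum_i w i x * x 0 i) ^+ 2) +
       Int (fun x => \sum_i w i x * x 0 i) ^+ 2
       - 2 * \sum_i Int (fun x => (\sum_j w j x * x 0 j) * x 0 i) * Int (w i)
       + vol / 5 * Int (sqn w)
       + \sum_i \sum_j moment w i j * moment w j i).
Proof.
move=> cw; pose a (x : V) := \sum_i w i x * x 0 i.
have ca : cont a by apply: cont_sum => i; apply: contM => //; exact: cont_coord.
have cc (c : R) : cont (fun _ : V => c) := @cont_cst R c.
(* With [r = (w . x, - w)] and [s = (1, x)] in R^4, [pair_diff w x y = r x . s y + s x . r y]. *)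
pose r (k : 'I_4) (x : V) : R := oapp (fun i => - w i x) (a x) (unlift ord0 k).
pose s (k : 'I_4) (x : V) : R := oapp (fun i => x 0 i) 1 (unlift ord0 k).
have r0 x : r ord0 x = a x by rewrite /r unlift_none.
have rS i x : r (lift ord0 i) x = - w i x by rewrite /r liftK.
have s0 x : s ord0 x = 1 by rewrite /s unlift_none.
have sS i x : s (lift ord0 i) x = x 0 i by rewrite /s liftK.
have cr k : cont (r k).
  by rewrite /r; case: unliftP => [i _|_] //=; exact: contN.
have cs k : cont (s k).
  by rewrite /s; case: unliftP => [i _|_] //=; exact: cont_coord.
have -> : Int (fun x => Int (fun y => pair_diff w x y ^+ 2)) =
   Int (fun x => Int (fun y => (\sum_k (r k x * s k y + s k x * r k y)) ^+ 2)).
  apply: integral3_eq => x _; apply: integral3_eq => y _; congr (_ ^+ 2).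
  by rewrite big_ord_recl r0 s0 r0 s0 !sum3 !rS !sS /pair_diff /a !sum3; ring.
rewrite Int_square_sum//; congr (2 * _).
have E (f g : V -> R) : f =1 g -> Int f = Int g by move=> /funext ->.
have I00 : Int (fun x => s ord0 x * s ord0 x) = vol.
  by apply: E => x; rewrite s0 mulr1.
have I0S i : Int (fun x => s ord0 x * s (lift ord0 i) x) = 0.
  by rewrite -(@Int_coord R i); apply: E => x; rewrite s0 sS mul1r.
have IS0 i : Int (fun x => s (lift ord0 i) x * s ord0 x) = 0.
  by rewrite -(@Int_coord R i); apply: E => x; rewrite s0 sS mulr1.
have ISS i j : Int (fun x => s (lift ord0 i) x * s (lift ord0 j) x) = (i == j)%:R * (vol / 5).
  by rewrite -Int_coordM; apply: E => x; rewrite !sS.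
have R00 : Int (fun x => r ord0 x * r ord0 x) = Int (fun x => a x ^+ 2).
  by apply: E => x; rewrite r0 expr2.
have RSS i : Int (fun x => r (lift ord0 i) x * r (lift ord0 i) x) = Int (fun x => w i x ^+ 2).
  by apply: E => x; rewrite !rS; ring.
have A00 : Int (fun x => r ord0 x * s ord0 x) = Int a.
  by apply: E => x; rewrite r0 s0 mulr1.
have A00' : Int (fun x => s ord0 x * r ord0 x) = Int a.
  by apply: E => x; rewrite r0 s0 mul1r.
have A0S i : Int (fun x => r ord0 x * s (lift ord0 i) x) = Int (fun x => a x * x 0 i).
  by apply: E => x; rewrite r0 sS.
have AS0' i : Int (fun x => s (lift ord0 i) x * r ord0 x) = Int (fun x => a x * x 0 i).
  by apply: E => x; rewrite r0 sS mulrC.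
have neg (f : V -> R) : cont f -> Int (fun x => -1 * f x) = - Int f.
  by move=> cf; rewrite integral3Z// mulN1r.
have AS0 i : Int (fun x => r (lift ord0 i) x * s ord0 x) = - Int (w i).
  by rewrite -neg//; apply: E => x; rewrite rS s0; ring.
have A0S' i : Int (fun x => s ord0 x * r (lift ord0 i) x) = - Int (w i).
  by rewrite -neg//; apply: E => x; rewrite rS s0; ring.
have ASS i j : Int (fun x => r (lift ord0 i) x * s (lift ord0 j) x) = - moment w i j.
  rewrite -neg; last by apply: contM => //; exact: cont_coord.
  by apply: E => x; rewrite rS sS; ring.
have ASS' i j : Int (fun x => s (lift ord0 i) x * r (lift ord0 j) x) = - moment w j i.
  rewrite -neg; last by apply: contM => //; exact: cont_coord.
  by apply: E => x; rewrite rS sS; ring.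
have Isq : Int (sqn w) = \sum_i Int (fun x => w i x ^+ 2).
  by rewrite Int_sum// => i; exact: contX.
pose T k l := Int (fun x => r k x * r l x) * Int (fun x => s k x * s l x) +
  Int (fun x => r k x * s l x) * Int (fun x => s k x * r l x).
have T00 : T ord0 ord0 = vol * Int (fun x => a x ^+ 2) + Int a ^+ 2.
  by rewrite /T I00 R00 A00 A00'; ring.
have T0S i : T ord0 (lift ord0 i) = - (Int (fun x => a x * x 0 i) * Int (w i)).
  by rewrite /T I0S A0S A0S'; ring.
have TS0 i : T (lift ord0 i) ord0 = - (Int (fun x => a x * x 0 i) * Int (w i)).
  by rewrite /T IS0 AS0 AS0'; ring.
have TSS i j : T (lift ord0 i) (lift ord0 j) =
    (i == j)%:R * (vol / 5) * Int (fun x => w i x ^+ 2) + moment w i j * moment w j i.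
  rewrite /T ISS ASS ASS'; have [->|_] := eqVneq i j; last by rewrite !mul0r mulr0; ring.
  by rewrite RSS; ring.
transitivity (\sum_k \sum_l T k l); first by [].
transitivity (\sum_l T ord0 l + \sum_(i < 3) \sum_l T (lift ord0 i) l).
  exact: big_ord_recl.
rewrite Isq -/a [\sum_l T ord0 l]big_ord_recl T00 (eq_bigr _ (fun i _ => T0S i)).
under [X in _ + _ + X = _]eq_bigr => i _.
  rewrite big_ord_recl TS0 (eq_bigr _ (fun j _ => TSS i j)).
  over.
(* The integrals are generalised to arbitrary reals, which leaves a polynomial identity. *)
have collect (b A A0 : R) (al be W : 'I_3 -> R) (m : 'I_3 -> 'I_3 -> R) :
    b * A + A0 ^+ 2 + \sum_i - (al i * be i) +
    \sum_i (- (al i * be i) + \sum_j ((i == j)%:R * (b / 5) * W i + m i j * m j i)) =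
    b * A + A0 ^+ 2 - 2 * \sum_i al i * be i + b / 5 * \sum_i W i + \sum_i \sum_j m i j * m j i.
  by rewrite !sum3 /=; ring.
exact: (collect _ _ _ (fun i => Int (fun x => a x * x 0 i)) (fun i => Int (w i))
  (fun i => Int (fun x => w i x ^+ 2)) (moment w)).
Qed.

(** The field x_i w is again tangential, with divergence w_i + x_i div w, so the mean of w_i is
    minus that of x_i div w. The divergence is a trace of the strain: (div w)^2 <= 3 sum (w' i i)^2
    <= sum (2 w' i i)^2. *)
Lemma Int_coord_moment_le (w : 'I_3 -> V -> R) w' : (forall i, has_grad (w i) (w' i)) ->
  tangential w -> \sum_i Int (w i) ^+ 2 <= vol * Int (strain2 w').
Proof.
move=> hw tw; have cw i : cont (w i) by case: (hw i).
have cw' i j : cont (w' i j) by case: (hw i).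
have cc (c : R) : cont (fun _ : V => c) := @cont_cst R c.
pose d x := \sum_j w' j j x.
have cd : cont d by exact: cont_sum.
have cE : cont (strain2 w').
  by apply: cont_sum => i; apply: cont_sum => j; apply: contX; exact: contD.
have E i : Int (w i) = - Int (fun x => x 0 i * d x).
  have H j := has_gradM (hw j) (@has_grad_coord R i).
  have := Int_div_tangential0 H => /(_ _)/wrap[].
    move=> x xS; rewrite (eq_bigr (fun j => x 0 i * (w j x * x 0 j))); last by move=> j _; ring.
    by rewrite -big_distrr /= tw// mulr0.
  rewrite (integral3_eq (g := fun x => 1 * (x 0 i * d x) + 1 * w i x)).
    rewrite Int_lin2//; last by apply: contM => //; exact: cont_coord.
    by move=> h; lra.
  by move=> x _; rewrite /d !sum3; elim/ord3P: i {H} => /=; ring.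
have cxd i : cont (fun x => x 0 i * d x) by apply: contM => //; exact: cont_coord.
apply: (@le_trans _ _ (\sum_i vol * Int (fun x => (x 0 i * d x) ^+ 2))).
  by apply: ler_sum => i _; rewrite E sqrrN; exact: Int_CS.
rewrite -big_distrr /= ler_wpM2l ?(ltW vol_gt0)// -Int_sum => [|i]; last exact: contX.
apply: integral3_le => //; first by apply: cont_sum => i; exact: contX.
move=> x; rewrite /unit_ball /= => xB.
have dS : d x ^+ 2 <= strain2 w' x.
  apply: (@le_trans _ _ (\sum_i (2 * w' i i x) ^+ 2)).
    apply: le_trans (sqr_sum3_le _) _; rewrite !sum3.
    by have := sqr_ge0 (w' 0 0 x); have := sqr_ge0 (w' 1 1 x); have := sqr_ge0 (w' 2 2 x); nra.
  rewrite /strain2; apply: ler_sum => i _.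
  rewrite (bigD1 i)//= (_ : 2 * _ = w' i i x + w' i i x); last by ring.
  by rewrite lerDl; apply: sumr_ge0 => j _; exact: sqr_ge0.
apply: le_trans dS.
rewrite (eq_bigr (fun i => d x ^+ 2 * (x 0 i * x 0 i))); last by move=> i _; ring.
by rewrite -big_distrr /= -/(dot x x) ler_piMr ?sqr_ge0// ltW.
Qed.

(** In [pair_diff_expand] symmetry makes the moment term nonnegative. The mixed term is split by 2ab
    <= a^2 + b^2: one half is absorbed by vol int (w . x)^2, the other is bounded by
    [Int_coord_moment_le]. What survives is [vol / 5] times int |w|^2, whence the constant. *)
Lemma korn_poincare_sym : exists2 C : R, 0 < C & forall w w', c1_field w w' ->
  tangential w -> (forall i j, moment w i j = moment w j i) ->
  Int (sqn w) <= C * Int (strain2 w').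
Proof.
have v0 := @vol_gt0 R.
set K := (36 * fine (sfprod (sfprod (@lebesgue_measure R) (@lebesgue_measure R)) (@lebesgue_measure R) (cube 2))).
have K0 : 0 <= K by rewrite mulr_ge0// fine_ge0// measure_ge0.
exists (5 / vol * (K / 2 + vol)).
  by rewrite mulr_gt0// ?divr_gt0// ltr_wpDl// divr_ge0.
move=> w w' cfw tw sym; have [hw _] := cfw.
have cw i : cont (w i) by case: (hw i).
pose a (x : V) := \sum_i w i x * x 0 i.
have ca : cont a by apply: cont_sum => i; apply: contM => //; exact: cont_coord.
have := segment_bound cfw; rewrite -/K pair_diff_expand// -/a.
have mom0 : 0 <= \sum_i \sum_j moment w i j * moment w j i.
  by apply: sumr_ge0 => i _; apply: sumr_ge0 => j _; rewrite sym -expr2 sqr_ge0.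
have bet := Int_coord_moment_le hw tw.
have cai i : cont (fun x => a x * x 0 i) by apply: contM => //; exact: cont_coord.
have alp : \sum_i Int (fun x => a x * x 0 i) ^+ 2 <= vol * Int (fun x => a x ^+ 2).
  apply: (@le_trans _ _ (\sum_i vol * Int (fun x => (a x * x 0 i) ^+ 2))).
    by apply: ler_sum => i _; exact: Int_CS.
  rewrite -big_distrr /= ler_wpM2l ?(ltW v0)// -Int_sum => [|i]; last exact: contX.
  apply: integral3_le.
  - by apply: cont_sum => i; exact: contX.
  - exact: contX.
  move=> x; rewrite /unit_ball /= => xB.
  rewrite (eq_bigr (fun i => a x ^+ 2 * (x 0 i * x 0 i))); last by move=> i _; ring.
  by rewrite -big_distrr /= -/(dot x x) ler_piMr ?sqr_ge0// ltW.
have ab : 2 * \sum_i Int (fun x => a x * x 0 i) * Int (w i) <=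
    \sum_i Int (fun x => a x * x 0 i) ^+ 2 + \sum_i Int (w i) ^+ 2.
  rewrite big_distrr /= -big_split /=; apply: ler_sum => i _.
  by have := sqr_ge0 (Int (fun x => a x * x 0 i) - Int (w i)); nra.
have A2 := sqr_ge0 (Int a).
move: mom0 bet alp ab A2.
set m := \sum_i \sum_j _; set b := \sum_i Int (w i) ^+ 2; set al := \sum_i _ ^+ 2.
set ab := \sum_i _ * _; set I := Int (strain2 w'); set A := Int (fun x => a x ^+ 2).
set X := Int (sqn w); set A0 := Int a ^+ 2 => m0 bet alp abl A00 Q.
have : vol / 5 * X <= (K / 2 + vol) * I by lra.
move=> h; rewrite [leLHS](_ : X = 5 / vol * (vol / 5 * X)); last by field; rewrite gt_eqF.
by rewrite -[leRHS]mulrA ler_wpM2l// divr_ge0// ltW.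
Qed.

End KornPoincare.

(** * Gradient bound *)

Section GradientBound.
Context {R : realType}.
Local Notation V := 'rV[R]_3.
Local Notation Int := (integral3 (@unit_ball R)).

(* [v'' i j k] is the [k]-th partial derivative of [v' i j]. *)
Definition c2_field (v : 'I_3 -> V -> R) v' (v'' : 'I_3 -> 'I_3 -> 'I_3 -> V -> R) :=
  [/\ c1_field v v', (forall i j, has_grad (v' i j) (v'' i j)) &
      forall i j k x, unit_cball x -> v'' i j k x = v'' i k j x].

Lemma differentiable_sum3 (f : 'I_3 -> V -> R) x :
  (forall i, differentiable (f i) x) -> differentiable (fun y => \sum_i f i y) x.
Proof.
move=> df; rewrite (_ : (fun y => _) = f 0 + f 1 + f 2).
  by apply: differentiableD => //; exact: differentiableD.
by apply/funext => y; rewrite sum3.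
Qed.

(* Differentiates [v . x = 0] along the great circle through [x] with velocity [v x]. *)
Lemma tangential_derive (v : 'I_3 -> V -> R) v' x : c1_field v v' -> tangential v ->
  unit_sphere x ->
  \sum_j v j x * (\sum_i v' i j x * x 0 i) + sqn v x = 0.
Proof.
move=> cv tv xS; have xB : unit_cball x by rewrite /unit_cball /= xS.
have [_ dv] := cv.
have [n0|n0] := eqVneq (sqn v x) 0.
  have v0 j : v j x = 0.
    apply/eqP; rewrite -sqrf_eq0; move/eqP: n0.
    rewrite /sqn psumr_eq0 => [/allP/(_ j)|i _]; last exact: sqr_ge0.
    by rewrite mem_index_enum => /(_ isT).
  by rewrite n0 addr0 big1// => j _; rewrite v0 mul0r.
have npos : 0 < sqn v x by rewrite lt0r n0 sumr_ge0// => i _; exact: sqr_ge0.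
pose n := Num.sqrt (sqn v x).
have np : 0 < n by rewrite sqrtr_gt0.
have n2 : n ^+ 2 = sqn v x by rewrite sqr_sqrtr// ltW.
pose tau : V := \row_j v j x.
pose g (y : V) := \sum_i v i y * y 0 i.
have dg : differentiable g x.
  apply: differentiable_sum3 => i; apply: differentiableM; first exact: dv.
  exact: differentiable_coord.
(* The circle has unit speed, so the direction is divided by [n = |v x|]; this is why the case
   [v x = 0] was settled first. *)
pose gam (s : R) : V := cos s *: x + sin s *: (n^-1 *: tau).
have gam0 : gam 0 = x by rewrite /gam cos0 sin0 scale1r scale0r addr0.
have dcos : differentiable (cos : R -> R) 0 by apply/derivable1_diffP; case: (is_derive_cos (0 : R)).
have dsin : differentiable (sin : R -> R) 0 by apply/derivable1_diffP; case: (is_derive_sin (0 : R)).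
pose ca (s : R) : V := cos s *: x.
pose sa (s : R) : V := sin s *: (n^-1 *: tau).
have dca : differentiable ca 0 by exact: differentiableZl.
have dsa : differentiable sa 0 by exact: differentiableZl.
have gamD : gam = ca + sa by [].
have dgam : differentiable gam 0 by rewrite gamD; exact: differentiableD.
have cos1 : 'd (cos : R -> R) 0 1 = 0.
  by rewrite -deriveE//; have [_ ->] := is_derive_cos (0 : R); rewrite sin0 oppr0.
have sin1 : 'd (sin : R -> R) 0 1 = 1.
  by rewrite -deriveE//; have [_ ->] := is_derive_sin (0 : R); rewrite cos0.
have gamE : 'd gam 0 1 = n^-1 *: tau.
  have e1 := diffD dca dsa.
  have e2 := diffZl x dcos.
  have e3 := diffZl (n^-1 *: tau) dsin.
  have {}e1 := congr1 (fun h : R -> V => h 1) e1.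
  have {}e2 := congr1 (fun h : R -> V => h 1) e2.
  have {}e3 := congr1 (fun h : R -> V => h 1) e3.
  cbv beta in e2, e3.
  rewrite cos1 scale0r in e2.
  rewrite sin1 scale1r in e3.
  rewrite gamD.
  apply: (etrans e1).
  apply: (etrans (congr2 +%R e2 e3)).
  exact: add0r.
have gg : g \o gam = cst 0.
  apply/funext => s /=; apply: (tv (gam s)); rewrite /unit_sphere /=.
  have t0 : dot x tau = 0.
    by rewrite -(tv x xS); apply: eq_bigr => i _; rewrite mxE mulrC.
  have tt : dot tau tau = n ^+ 2.
    by rewrite n2; apply: eq_bigr => i _; rewrite mxE expr2.
  have -> : dot (gam s) (gam s) = cos s ^+ 2 * dot x x +
      2 * cos s * sin s * n^-1 * dot x tau + sin s ^+ 2 * (n^-1) ^+ 2 * dot tau tau.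
    rewrite /gam /dot !sum3; set z := tau; rewrite !mxE; ring.
  rewrite xS t0 tt mulr0 addr0 mulr1 -mulrA -exprMn mulVf ?gt_eqF// expr1n mulr1.
  exact: cos2Dsin2.
have := @diff_comp _ _ _ _ gam g 0 dgam; rewrite gam0 => /(_ dg) dd.
have : 'd (g \o gam) 0 1 = 0 by rewrite gg diff_cst.
rewrite dd /= gamE linearZ /= => /eqP; rewrite mulf_eq0 invr_eq0 gt_eqF//= => /eqP.
rewrite -deriveE//.
have h i := is_deriveM (c1_is_derive i tau cv xB) (is_derive_coord x tau i).
have := is_deriveD (is_deriveD (h 0) (h 1)) (h 2) => -[_].
rewrite (_ : _ + _ = g :> (V -> R)); last by apply/funext => y; rewrite /g sum3.
move=> -> E; rewrite -[RHS]E /GRing.scale /= /sqn !sum3.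
have t i : tau 0 i = v i x by rewrite mxE.
by rewrite !t; ring.
Qed.

Lemma gradient_bound v v' v'' : c2_field v v' v'' -> tangential v ->
  Int (fun x => \sum_i \sum_j v' i j x ^+ 2) <=
  3 / 2 * Int (strain2 v') + 7 * Int (sqn v).
Proof.
move=> [cv hv' sym] tv; have [hv _] := cv.
have c i : cont (v i) by case: (hv i).
have c' i j : cont (v' i j) by case: (hv i).
(* [H] is about the components of [(v . grad) v - v div v + x |v|^2 + 2 v (x . v)]; the last
   two terms make it tangential, and Schwarz cancels the second derivatives of [v]. *)
pose hx i := @has_grad_coord R i.
pose hdiv := has_grad_sum (fun j => hv' j j).
pose hsq := has_grad_sum (fun j => has_gradM (hv j) (hv j)).
pose hxv := has_grad_sum (fun j => has_gradM (hx j) (hv j)).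
pose H i := has_gradD
  (has_gradB (has_grad_sum (fun j => has_gradM (hv j) (hv' i j))) (has_gradM (hv i) hdiv))
  (has_gradD (has_gradM (hx i) hsq) (has_gradM (has_grad_cst 2) (has_gradM (hv i) hxv))).
have := Int_div_tangential0 H => /(_ _)/wrap[].
  move=> x xS; have := tangential_derive cv tv xS; have := tv x xS.
  move: xS; rewrite /unit_sphere /= dot3E /sqn !sum3 => q1 t0 <-.
  set d := _ + _ + v' 2 2 x.
  (* The normal component equals that of [tangential_derive] only modulo x . v = 0 and |x|^2 = 1.
     These are inserted with the multipliers 2 (x . v) - d and |v|^2, which makes the equality
     polynomial. *)
  rewrite -[RHS]addr0 -(mulr0 (2 * (x 0 0 * v 0 x + x 0 1 * v 1 x + x 0 2 * v 2 x) - d)) -t0.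
  rewrite -[in RHS](mul1r (v 0 x ^+ 2 + _ + _)) -q1; ring.
set K := fun x : V => _ => K0.
have cK : cont K.
  by apply: cont_sum => i; case: (H i).
have cE : cont (strain2 v').
  by apply: cont_sum => i; apply: cont_sum => j; apply: contX; exact: contD.
have cG : cont (fun x => \sum_i \sum_j v' i j x ^+ 2).
  by apply: cont_sum => i; apply: cont_sum => j; exact: contX.
have cS : cont (sqn v) by apply: cont_sum => i; exact: contX.
have cst2 := @cont_cst R.
rewrite -Int_lin2//.
have -> : Int (fun x => \sum_i \sum_j v' i j x ^+ 2) =
    Int (fun x => \sum_i \sum_j v' i j x ^+ 2 + K x) by rewrite integral3D// K0 addr0.
apply: integral3_le.
- exact: contD.
- by apply: contD; apply: contM => //; exact: cont_cst.
move=> x xB; have xC := unit_ballW xB.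
pose d := \sum_j v' j j x.
pose xv := \sum_i x 0 i * v i x.
(* The first two terms of the field contribute tr((grad v)^2) - d^2, and tr((grad v)^2) completes
   |grad v|^2 to half of [strain2]. The derivatives produced by the two correction terms also
   combine into entries of the strain and the divergence [d]. *)
have -> : \sum_i \sum_j v' i j x ^+ 2 + K x = 1 / 2 * strain2 v' x - d ^+ 2 + 5 * sqn v x +
    \sum_i \sum_j 2 * (x 0 i * v j x) * (v' i j x + v' j i x) + 2 * d * xv.
  rewrite /K /d /xv /strain2 /sqn !sum3 /=.
  rewrite (sym 0 1 0)// (sym 0 2 0)// (sym 1 0 1)// (sym 1 2 1)// (sym 2 0 2)// (sym 2 1 2)//.
  by field.
have xv2 : xv ^+ 2 <= sqn v x.
  apply: (@le_trans _ _ (dot x x * sqn v x)).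
    rewrite /xv /sqn dot3E !sum3.
    have := sqr_ge0 (x 0 0 * v 1 x - x 0 1 * v 0 x).
    have := sqr_ge0 (x 0 0 * v 2 x - x 0 2 * v 0 x).
    have := sqr_ge0 (x 0 1 * v 2 x - x 0 2 * v 1 x).
    by nra.
  by apply: ler_piMl; [apply: sumr_ge0 => i _; exact: sqr_ge0|exact: ltW].
have cross : \sum_i \sum_j 2 * (x 0 i * v j x) * (v' i j x + v' j i x) <=
    strain2 v' x + sqn v x.
  apply: (@le_trans _ _ (strain2 v' x + dot x x * sqn v x)).
    have -> : dot x x * sqn v x = \sum_i \sum_j (x 0 i * v j x) ^+ 2.
      by rewrite dot3E /sqn !sum3; ring.
    rewrite -big_split; apply: ler_sum => i _; rewrite -big_split; apply: ler_sum => j _ /=.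
    by have := sqr_ge0 (x 0 i * v j x - (v' i j x + v' j i x)); nra.
  rewrite lerD2l; apply: ler_piMl; [apply: sumr_ge0 => i _; exact: sqr_ge0|exact: ltW].
(* Completing the square turns - d^2 + 2 d xv into at most xv^2 <= |v|^2. So 7 = 5 + 1 + 1 and 3/2 =
   1/2 + 1, with [cross] giving one unit to each. *)
have := sqr_ge0 (d - xv).
have : (d - xv) ^+ 2 = d ^+ 2 - 2 * d * xv + xv ^+ 2 by ring.
by move=> e1 e2; lra.
Qed.

End GradientBound.

(** * Rotations and angular momentum *)

Section Momentum.
Context {R : realType}.
Local Notation V := 'rV[R]_3.
Local Notation Int := (integral3 (@unit_ball R)).

Definition rot (a : V) (i : 'I_3) (x : V) : R := cross x a 0 i.

(** As [rot a] is linear in [x], its [j]-th derivative is its value at the [j]-th basis vector. *)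
Definition rot' (a : V) (i j : 'I_3) (_ : V) : R := cross (Defs.basis j) a 0 i.

Lemma rotE a x : (rot a 0 x = x 0 1 * a 0 2 - x 0 2 * a 0 1) *
  (rot a 1 x = x 0 2 * a 0 0 - x 0 0 * a 0 2) *
  (rot a 2 x = x 0 0 * a 0 1 - x 0 1 * a 0 0).
Proof. by rewrite /rot /cross /vec3 !mxE. Qed.

Lemma has_grad_rot a i : has_grad (rot a i) (rot' a i).
Proof.
have h j (c : R) := has_gradM (@has_grad_coord R j) (has_grad_cst c).
have e (j k : 'I_3) : Defs.basis j 0 k = (j == k)%:R :> R by rewrite mxE eqxx eq_sym.
elim/ord3P: i.
- apply: has_grad_eq (has_gradB (h 1 (a 0 2)) (h 2 (a 0 1))) _ _ => [x|j x].
    by rewrite rotE.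
  by rewrite -[RHS]/(rot a 0 (Defs.basis j)) rotE !e; ring.
- apply: has_grad_eq (has_gradB (h 2 (a 0 0)) (h 0 (a 0 2))) _ _ => [x|j x].
    by rewrite rotE.
  by rewrite -[RHS]/(rot a 1 (Defs.basis j)) rotE !e; ring.
- apply: has_grad_eq (has_gradB (h 0 (a 0 1)) (h 1 (a 0 0))) _ _ => [x|j x].
    by rewrite rotE.
  by rewrite -[RHS]/(rot a 2 (Defs.basis j)) rotE !e; ring.
Qed.

Lemma differentiable_rot a i x : differentiable (rot a i) x.
Proof.
have h j (c : R) : differentiable (fun y : V => y 0 j * c) x.
  by apply: differentiableM; [exact: differentiable_coord|exact: differentiable_cst].
elim/ord3P: i.
- rewrite (_ : rot a 0 = (fun y : V => y 0 1 * a 0 2) - (fun y : V => y 0 2 * a 0 1)).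
    exact: differentiableB.
  by apply/funext => y; rewrite rotE.
- rewrite (_ : rot a 1 = (fun y : V => y 0 2 * a 0 0) - (fun y : V => y 0 0 * a 0 2)).
    exact: differentiableB.
  by apply/funext => y; rewrite rotE.
- rewrite (_ : rot a 2 = (fun y : V => y 0 0 * a 0 1) - (fun y : V => y 0 1 * a 0 0)).
    exact: differentiableB.
  by apply/funext => y; rewrite rotE.
Qed.

Lemma c1_field_rot a : c1_field (rot a) (rot' a).
Proof. by split=> [i|i x _]; [exact: has_grad_rot|exact: differentiable_rot]. Qed.

Lemma c1_fieldB (v w : 'I_3 -> V -> R) v' w' : c1_field v v' -> c1_field w w' ->
  c1_field (fun i x => v i x - w i x) (fun i j x => v' i j x - w' i j x).
Proof.
move=> [hv dv] [hw dw]; split=> [i|i x xB]; first exact: has_gradB.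
by apply: differentiableB; [exact: dv|exact: dw].
Qed.

Lemma rot_tangential a : tangential (rot a).
Proof. by move=> x _; rewrite sum3 !rotE; ring. Qed.

Lemma rot'_antisym a i j x : rot' a i j x = - rot' a j i x.
Proof.
rewrite /rot' -!/(rot a _ _).
have e (k l : 'I_3) : Defs.basis k 0 l = (k == l)%:R :> R by rewrite mxE eqxx eq_sym.
by elim/ord3P: i; elim/ord3P: j; rewrite !rotE !e /=; ring.
Qed.

Lemma strain2_rotB v' a x :
  strain2 (fun i j x => v' i j x - rot' a i j x) x = strain2 v' x.
Proof.
apply: eq_bigr => i _; apply: eq_bigr => j _; congr (_ ^+ 2).
by rewrite (rot'_antisym a i j); ring.
Qed.

(** An antisymmetric matrix in (i, j), with [vol / 5] as the scale that will determine [a] in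
    [korn_rotation]. *)
Lemma moment_rot a j : let m := vol / 5 in
  (moment (rot a) 0 j = m * ((1 == j)%:R * a 0 2 - (2 == j)%:R * a 0 1)) *
  (moment (rot a) 1 j = m * ((2 == j)%:R * a 0 0 - (0 == j)%:R * a 0 2)) *
  (moment (rot a) 2 j = m * ((0 == j)%:R * a 0 1 - (1 == j)%:R * a 0 0)).
Proof.
move=> m.
have h k l (c d : R) : Int (fun x => (x 0 k * c - x 0 l * d) * x 0 j) =
    m * ((k == j)%:R * c - (l == j)%:R * d).
  rewrite (integral3_eq (g := fun x => c * (x 0 k * x 0 j) + (- d) * (x 0 l * x 0 j))).
    by rewrite Int_lin2 ?Int_coordM -/m; [ring|apply: contM; exact: cont_coord..].
  by move=> x _; ring.
by rewrite /moment; split; [split|]; rewrite -h; apply: integral3_eq => x _; rewrite rotE.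
Qed.

Lemma korn_rotation : exists2 C : R, 0 < C & forall (v : 'I_3 -> V -> R) v',
  c1_field v v' -> tangential v ->
  exists a, Int (sqn (fun i x => v i x - rot a i x)) <= C * Int (strain2 v').
Proof.
have [C C0 HC] := @korn_poincare_sym R; exists C => // v v' cv tv.
(* Subtracting [rot a] lowers M_01 and raises M_10 by a_2 vol / 5, and cyclically; equality of the
   two forces a_2 = 5 / (2 vol) * (M_01 - M_10). *)
pose M := moment v; pose k := 5 / (2 * @vol R).
pose a : V := vec3 (k * (M 1 2 - M 2 1)) (k * (M 2 0 - M 0 2)) (k * (M 0 1 - M 1 0)).
exists a; have [hv _] := cv.
have cc := c1_fieldB cv (c1_field_rot a).
have := HC _ _ cc; rewrite (integral3_eq (fun x _ => strain2_rotB v' a x)); apply.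
  move=> x xS; rewrite (eq_bigr (fun i => v i x * x 0 i - rot a i x * x 0 i)).
    by rewrite big_split /= sumrN tv// rot_tangential// subr0.
  by move=> i _; rewrite mulrBl.
have mB i j : moment (fun i x => v i x - rot a i x) i j = M i j - moment (rot a) i j.
  have ci : cont (fun x => v i x * x 0 j).
    by apply: contM; [case: (hv i)|exact: cont_coord].
  have cr : cont (fun x => rot a i x * x 0 j).
    by apply: contM; [case: (has_grad_rot a i)|exact: cont_coord].
  rewrite /moment (integral3_eq (g := fun x => 1 * (v i x * x 0 j) + (-1) * (rot a i x * x 0 j))).
    by rewrite Int_lin2// /M /moment; ring.
  by move=> x _; ring.
have v0 := lt0r_neq0 (@vol_gt0 R).
have aE : (a 0 0 = k * (M 1 2 - M 2 1)) * (a 0 1 = k * (M 2 0 - M 0 2)) *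
    (a 0 2 = k * (M 0 1 - M 1 0)) by rewrite !mxE.
by elim/ord3P => //; elim/ord3P => //; rewrite !mB !moment_rot !aE /k /=; move: v0;
  generalize (@vol R) M => b N b0; field.
Qed.

Lemma sqn_ge0 (v : 'I_3 -> V -> R) x : 0 <= sqn v x.
Proof. by apply: sumr_ge0 => i _; exact: sqr_ge0. Qed.

(** Young's inequality with weight e/4: two uses with [e = rmin] cost half of [rmin * r ^+ 2], and
    the other half remains for the estimate. *)
Lemma young_rotation (k e r y : R) : e * k = 1 -> 0 <= k ->
  - (y * r) <= e / 4 * r ^+ 2 + k * y ^+ 2.
Proof.
move=> ek k0.
have : 0 <= k * (e * r / 2 + y) ^+ 2 by rewrite mulr_ge0// sqr_ge0.
have -> : k * (e * r / 2 + y) ^+ 2 =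
  (e * k) * (e / 4 * r ^+ 2) + (e * k) * (y * r) + k * y ^+ 2 by field.
by rewrite ek !mul1r; lra.
Qed.

Lemma korn_momentum (rmin rmax : R) : 0 < rmin -> exists2 C : R, 0 < C &
  forall (v ub : 'I_3 -> V -> R) v' v'' (rho rb : V -> R),
  c2_field v v' v'' -> tangential v -> (forall i, cont (ub i)) -> cont rho -> cont rb ->
  (forall x, unit_ball x -> rmin <= rb x <= rmax) ->
  (forall a, Int (fun x => rho x * \sum_i (v i x + ub i x) * rot a i x) =
             Int (fun x => rb x * \sum_i ub i x * rot a i x)) ->
  Int (fun x => \sum_i \sum_j v' i j x ^+ 2) <=
  C * (Int (strain2 v') + Int (fun x => sqn ub x * (rho x - rb x) ^+ 2)
       + Int (fun x => (rho x - rb x) ^+ 2 * sqn v x)).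
Proof.
move=> rmin0; have [C1 C10 HC1] := korn_rotation.
pose k := rmin^-1; have k0 : 0 < k by rewrite invr_gt0.
have rk : rmin * k = 1 by rewrite divff ?gt_eqF.
(* With 7 and 3/2 from [gradient_bound] and |v|^2 <= 2 |w|^2 + 2 |r|^2: 14 = 7 * 2, 56 = 14 * 4 and
   28 = 14 * 2, where 4 and 2 are the factors in the final form of [HQ]. *)
exists (3 / 2 + 14 * C1 + 56 * k ^+ 2 + 28 * k ^+ 2 * rmax ^+ 2 * C1).
  have := sqr_ge0 k; have := sqr_ge0 rmax => h1 h2.
  have h3 := mulr_ge0 (mulr_ge0 h2 h1) (ltW C10).
  by lra.
move=> v ub v' v'' rho rb cv tv cub crho crb rbB mom.
have [cv1 _ _] := cv; have [hv _] := cv1.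
have c i : cont (v i) by case: (hv i).
have c' i j : cont (v' i j) by case: (hv i).
have cc := @cont_cst R.
have [a Ha] := HC1 _ _ cv1 tv.
have cr i : cont (rot a i) by case: (has_grad_rot a i).
pose w i x := v i x - rot a i x; rewrite -/w in Ha.
have cw i : cont (w i) by exact: contB.
have csq (f : 'I_3 -> V -> R) : (forall i, cont (f i)) -> cont (sqn f).
  by move=> cf; apply: cont_sum => i; exact: contX.
have cE : cont (strain2 v').
  by apply: cont_sum => i; apply: cont_sum => j; apply: contX; exact: contD.
pose d x := rho x - rb x.
have cd : cont d by exact: contB.
pose S := Int (strain2 v').
pose T2 := Int (fun x => sqn ub x * d x ^+ 2).
pose T3 := Int (fun x => d x ^+ 2 * sqn v x).
pose W := Int (sqn w); pose Q := Int (sqn (rot a)).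
have cT2 : cont (fun x => sqn ub x * d x ^+ 2) by apply: contM; [exact: csq|exact: contX].
have cT3 : cont (fun x => d x ^+ 2 * sqn v x) by apply: contM; [exact: contX|exact: csq].
have S0 : 0 <= S.
  apply: Int_ge0 => // x _; apply: sumr_ge0 => i _; apply: sumr_ge0 => j _; exact: sqr_ge0.
have T20 : 0 <= T2 by apply: Int_ge0 => // x _; rewrite mulr_ge0 ?sqn_ge0 ?sqr_ge0.
have T30 : 0 <= T3 by apply: Int_ge0 => // x _; rewrite mulr_ge0 ?sqn_ge0 ?sqr_ge0.
have G := gradient_bound cv tv; rewrite -/S in G.
have Hv : Int (sqn v) <= 2 * W + 2 * Q.
  rewrite /W /Q -Int_lin2; [|exact: csq..].
  apply: integral3_le; first exact: csq.
    by apply: contD; apply: contM => //; exact: csq.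
  move=> x _; rewrite /sqn /w !big_distrr -big_split; apply: ler_sum => i _ /=.
  by have := sqr_ge0 (v i x - 2 * rot a i x); nra.
(* The momentum condition says that [m] has integral zero; pointwise it is (rho - rb) (v + ub) . r +
   rb v . r, with r = [rot a]. *)
pose m x := rho x * (\sum_i (v i x + ub i x) * rot a i x) +
  (-1) * (rb x * \sum_i ub i x * rot a i x).
have c1 : cont (fun x => rho x * \sum_i (v i x + ub i x) * rot a i x).
  by apply: contM => //; apply: cont_sum => i; apply: contM => //; exact: contD.
have c2 : cont (fun x => rb x * \sum_i ub i x * rot a i x).
  by apply: contM => //; apply: cont_sum => i; exact: contM.
have cm : cont m by apply: contD => //; exact: contM.
have m0 : Int m = 0.
  rewrite -(subrr (Int (fun x => rb x * \sum_i ub i x * rot a i x))) -{1}mom.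
  rewrite /m (integral3_eq (g := fun x => 1 * (rho x * (\sum_i (v i x + ub i x) * rot a i x)) +
    (-1) * (rb x * \sum_i ub i x * rot a i x))) => [|x _]; last by rewrite mul1r.
  by rewrite Int_lin2//; ring.
(* Since [Int m = 0], adding it on the right reduces the claim to a pointwise inequality. There rb v
   . r = rb w . r + rb |r|^2 supplies rmin |r|^2, and the two indefinite products are handled by
   [young_rotation]. *)
have HQ : rmin / 2 * Q <= 2 * k * (T2 + T3) + k * rmax ^+ 2 * W.
  rewrite -[leRHS]add0r -m0.
  have -> : Int m + (2 * k * (T2 + T3) + k * rmax ^+ 2 * W) =
      Int (fun x => 1 * m x + 1 * (2 * k * (1 * (sqn ub x * d x ^+ 2) + 1 * (d x ^+ 2 * sqn v x)) +
        k * rmax ^+ 2 * sqn w x)).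
    rewrite Int_lin2//; last first.
      by apply: contD; apply: contM => //; [apply: contD; exact: contM|exact: csq].
    rewrite Int_lin2; [|by apply: contD; exact: contM|exact: csq].
    by rewrite Int_lin2// !mul1r.
  rewrite -integral3Z; last exact: csq.
  apply: integral3_le.
  - by apply: contM => //; exact: csq.
  - apply: contD; apply: contM => //; apply: contD; apply: contM => //.
      by apply: contD; exact: contM.
    exact: csq.
  move=> x /rbB /andP[r1 r2].
  have -> : 1 * m x + 1 * (2 * k * (1 * (sqn ub x * d x ^+ 2) + 1 * (d x ^+ 2 * sqn v x)) +
        k * rmax ^+ 2 * sqn w x) = \sum_i (d x * (v i x + ub i x) * rot a i x + rb x * v i x * rot a i x
        + 2 * k * d x ^+ 2 * (ub i x ^+ 2 + v i x ^+ 2) + k * rmax ^+ 2 * w i x ^+ 2).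
    by rewrite /m /sqn !sum3 /d; ring.
  rewrite /sqn big_distrr; apply: ler_sum => i _ /=.
  have y1 := @young_rotation k rmin (rot a i x) (d x * (v i x + ub i x)) rk (ltW k0).
  have y2 := @young_rotation k rmin (rot a i x) (rb x * w i x) rk (ltW k0).
  have b1 : rmin * rot a i x ^+ 2 <= rb x * rot a i x ^+ 2 by rewrite ler_wpM2r// sqr_ge0.
  have b2 : k * (rb x * w i x) ^+ 2 <= k * rmax ^+ 2 * w i x ^+ 2.
    rewrite -mulrA ler_wpM2l ?(ltW k0)// exprMn ler_wpM2r ?sqr_ge0//.
    by rewrite ler_sqr ?nnegrE//; lra.
  have b3 : k * (d x * (v i x + ub i x)) ^+ 2 <= 2 * k * d x ^+ 2 * (ub i x ^+ 2 + v i x ^+ 2).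
    rewrite (_ : 2 * k * _ * _ = k * (d x ^+ 2 * (2 * (ub i x ^+ 2 + v i x ^+ 2)))); last by ring.
    rewrite ler_wpM2l ?(ltW k0)// exprMn ler_wpM2l ?sqr_ge0//.
    by have := sqr_ge0 (v i x - ub i x); nra.
  have e1 : rb x * v i x * rot a i x = rb x * w i x * rot a i x + rb x * rot a i x ^+ 2.
    by rewrite /w; ring.
  by rewrite e1; lra.
have {}HQ : Q <= 4 * k ^+ 2 * (T2 + T3) + 2 * k ^+ 2 * rmax ^+ 2 * W.
  have := ler_wpM2l (ltW (mulr_gt0 (ltr0Sn R 1) k0)) HQ.
  have -> : 2 * k * (rmin / 2 * Q) = rmin * k * Q by field.
  by rewrite rk mul1r; lra.
have HW : k ^+ 2 * rmax ^+ 2 * W <= k ^+ 2 * rmax ^+ 2 * (C1 * S).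
  by rewrite ler_wpM2l// mulr_ge0// sqr_ge0.
rewrite -/d -/S -/T2 -/T3 in Ha *.
(* Nonnegative cross terms of the product C (S + T2 + T3), needed as slack by the final linear
   arithmetic. *)
have p1 : 0 <= C1 * (T2 + T3) by rewrite mulr_ge0 ?addr_ge0// ltW.
have p2 : 0 <= k ^+ 2 * S by rewrite mulr_ge0// sqr_ge0.
have p3 : 0 <= k ^+ 2 * rmax ^+ 2 * (C1 * (T2 + T3)) by rewrite mulr_ge0// mulr_ge0// sqr_ge0.
rewrite -/W in Ha.
have -> : (3 / 2 + 14 * C1 + 56 * k ^+ 2 + 28 * k ^+ 2 * rmax ^+ 2 * C1) * (S + T2 + T3) =
  3 / 2 * S + 3 / 2 * (T2 + T3) + 14 * (C1 * S) + 14 * (C1 * (T2 + T3)) + 56 * (k ^+ 2 * S)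
  + 56 * (k ^+ 2 * (T2 + T3)) + 28 * (k ^+ 2 * rmax ^+ 2 * (C1 * S)) +
  28 * (k ^+ 2 * rmax ^+ 2 * (C1 * (T2 + T3))) by ring.
move: G Hv HQ HW Ha p1 p2 p3; rewrite -/Q.
set X1 := k ^+ 2 * rmax ^+ 2 * (C1 * S); set X2 := k ^+ 2 * rmax ^+ 2 * (C1 * (T2 + T3)).
have -> : 4 * k ^+ 2 * (T2 + T3) + 2 * k ^+ 2 * rmax ^+ 2 * W =
  4 * (k ^+ 2 * (T2 + T3)) + 2 * (k ^+ 2 * rmax ^+ 2 * W) by ring.
by lra.
Qed.

End Momentum.

(** * Smooth functions *)

Section Smooth.
Context {R : realType}.
Local Notation V := 'rV[R]_3.
Local Notation basis := (@Defs.basis R).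

Definition linear_form (c : 'I_3 -> R) (h : V) : R := \sum_i h 0 i * c i.

Lemma linear_form_is_linear c : linear (linear_form c).
Proof.
move=> a h k; rewrite /linear_form scaler_sumr -big_split; apply: eq_bigr => i _.
by rewrite !mxE /GRing.scale /=; ring.
Qed.

HB.instance Definition _ c :=
  GRing.isLinear.Build R V R *:%R (linear_form c) (linear_form_is_linear c).

Lemma linear_form_continuous c : continuous (linear_form c).
Proof.
move=> x; rewrite (_ : linear_form c = fun h => h 0 0 * c 0 + h 0 1 * c 1 + h 0 2 * c 2).
  have cf i : {for x, continuous (fun h : V => h 0 i * c i)}.
    by apply: continuousM; [exact: coord_continuous|exact: cst_continuous].
  have H := @continuousD _ _ _ _ _ _ (@continuousD _ _ _ _ _ _ (cf 0) (cf 1)) (cf 2).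
  exact: H.
by apply/funext => h; rewrite /linear_form sum3.
Qed.

Definition c1_at (O : set V) (f : V -> R) (g : 'I_3 -> V -> R) :=
  forall x, O x -> forall i, is_derive x (basis i) f (g i x) /\ {for x, continuous (g i)}.

Lemma norm_basis i : `|basis i| <= 1.
Proof.
rewrite [`|_|]mx_normrE; apply: bigmax_le => // -[j k] _.
by rewrite ord1 mxE eqxx /=; case: (k == i); rewrite ?normr1 ?normr0.
Qed.

Lemma norm_coord_le (h : V) i : `|h 0 i| <= `|h|.
Proof.
rewrite [leRHS]mx_normrE.
exact: (le_bigmax 0 (fun ij : 'I_1 * 'I_3 => `|h ij.1 ij.2|) (0, i)).
Qed.

(** Mean value theorem between 0 and [h] regardless of the sign of [h]. *)
Lemma MVT0 (phi phi' : R -> R) (h : R) :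
  (forall t : R, `|t| <= `|h| -> is_derive t 1 phi (phi' t)) ->
  exists2 c, `|c| <= `|h| & phi h - phi 0 = phi' c * h.
Proof.
move=> dphi.
have cphi (t : R) : `|t| <= `|h| -> {for t, continuous phi}.
  by move=> /dphi [/derivable1_diffP/differentiable_continuous].
have [h0|h0] := leP 0 h.
  have H1 t : t \in `]0, h[ -> is_derive t 1 phi (phi' t).
    rewrite in_itv /= => /andP[t0 th]; apply: dphi.
    by rewrite !ger0_norm// ltW.
  have H2 : {within `[0, h], continuous phi}.
    apply: continuous_in_subspaceT => t; rewrite inE/= in_itv/= => /andP[t0 th].
    by apply: cphi; rewrite !ger0_norm.
  have [c] := MVT_segment h0 H1 H2.
  rewrite in_itv /= => /andP[c0 ch] ->; exists c; last by rewrite subr0.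
  by rewrite !ger0_norm.
have H1 t : t \in `]h, 0[ -> is_derive t 1 phi (phi' t).
  rewrite in_itv /= => /andP[t0 th]; apply: dphi.
  by rewrite !ler0_norm ?lerN2 ?ltW.
have H2 : {within `[h, 0], continuous phi}.
  apply: continuous_in_subspaceT => t; rewrite inE/= in_itv/= => /andP[t0 th].
  by apply: cphi; rewrite (ler0_norm th) (ltr0_norm h0) lerN2.
have [c] := MVT_segment (ltW h0) H1 H2.
rewrite in_itv /= => /andP[c0 ch] e; exists c; last by rewrite -opprB e sub0r mulrN opprK.
by rewrite (ler0_norm ch) (ltr0_norm h0) lerN2.
Qed.

Lemma differentiable_eps (U W : normedModType R) (f : U -> W) (df : {linear U -> W}) x :
  continuous df ->
  (forall e : R, 0 < e -> \forall h \near 0, `|f (h + x) - (f x + df h)| <= e * `|h|) ->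
  differentiable f x.
Proof.
move=> dfc dxf.
have H : f \o shift x = cst (f x) + df +o_ 0 id by apply/eqaddoP => e e0; exact: dxf.
by apply/diff_locallyP; rewrite (diff_unique dfc H).
Qed.

Lemma c1_step O f g (p : V) i (t : R) : c1_at O f g ->
  (forall s : R, `|s| <= `|t| -> O (p + s *: basis i)) ->
  exists2 c, `|c| <= `|t| & f (p + t *: basis i) - f p = g i (p + c *: basis i) * t.
Proof.
move=> fg inO.
have [|c ct e] := @MVT0 (fun s => f (p + s *: basis i)) (fun s => g i (p + s *: basis i)) t.
  by move=> s /inO h; apply: is_derive_line; case: (fg _ h i).
by exists c => //; rewrite -e scale0r addr0.
Qed.

Lemma continuous_dist (g : V -> R) x (e : R) : {for x, continuous g} -> 0 < e ->
  exists2 d : R, 0 < d & forall y, `|x - y| < d -> `|g x - g y| < e.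
Proof.
move=> cg e0; have /cvgr_dist_lt/(_ _ e0)/nbhs_normP[d /= d0 H] := cg.
by exists d.
Qed.

Lemma open_dist (O : set V) x : open O -> O x ->
  exists2 d : R, 0 < d & forall y, `|x - y| < d -> O y.
Proof.
move=> oO Ox; have /nbhs_normP[d /= d0 H] := open_nbhs_nbhs (conj oO Ox).
by exists d.
Qed.

Lemma dist3 (x : V) (a b c : R) i j k :
  `|x - (x + a *: basis i + b *: basis j + c *: basis k)| <= `|a| + `|b| + `|c|.
Proof.
rewrite (_ : x - _ = - (a *: basis i + b *: basis j + c *: basis k)); last first.
  by rewrite -!addrA opprD addNKr.
rewrite normrN; apply: le_trans (ler_normD _ _) _; apply: lerD.
  apply: le_trans (ler_normD _ _) _; apply: lerD;
  by rewrite normrZ ler_piMr// norm_basis.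
by rewrite normrZ ler_piMr// norm_basis.
Qed.

(** Go from [x] to [x + h] along the three axes and apply the mean value theorem to each leg;
    continuity of the partial derivatives at [x] makes each error at most e/3 times the norm of
    [h]. *)
Lemma c1_differentiable O f g x : open O -> O x -> c1_at O f g -> differentiable f x.
Proof.
move=> oO Ox fg.
apply: (@differentiable_eps _ _ f (linear_form (g ^~ x)) x).
  exact: linear_form_continuous.
move=> e e0.
have e3 : 0 < e / 3 by rewrite divr_gt0.
have [d dp dO] := open_dist oO Ox.
have cg i := continuous_dist (fg x Ox i).2 e3.
have [d0 d0p H0] := cg 0; have [d1 d1p H1] := cg 1; have [d2 d2p H2] := cg 2.
pose dd := Num.min (Num.min d d0) (Num.min d1 d2).
have ddp : 0 < dd by rewrite !lt_min dp d0p d1p d2p.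
have dd3 : 0 < dd / 3 by rewrite divr_gt0.
near=> h.
have hd : `|h| < dd / 3 by near: h; exact: (@nbhs0_lt _ V).
have hi i : `|h 0 i| < dd / 3 by exact: le_lt_trans (norm_coord_le h i) hd.
have small a b c : `|a| <= `|h 0 0| -> `|b| <= `|h 0 1| -> `|c| <= `|h 0 2| ->
    `|x - (x + a *: basis 0 + b *: basis 1 + c *: basis 2)| < dd.
  move=> ha hb hc; apply: le_lt_trans (dist3 _ _ _ _ _ _ _) _.
  by have := hi 0; have := hi 1; have := hi 2; lra.
have n0 i : `|0 : R| <= `|h 0 i| by rewrite normr0.
have lt_dd (y : V) : `|x - y| < dd -> [/\ `|x - y| < d, `|x - y| < d0, `|x - y| < d1 & `|x - y| < d2].
  by rewrite !lt_min => /andP[/andP[? ?] /andP[? ?]].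
have z0 y i : y + 0 *: basis i = y :> V by rewrite scale0r addr0.
have [|c0 c0h E0] := @c1_step O f g x 0 (h 0 0) fg.
  move=> s hs; have := small s 0 0 hs (n0 1) (n0 2); rewrite !z0 => /lt_dd [? _ _ _].
  exact: dO.
have [|c1 c1h E1] := @c1_step O f g (x + h 0 0 *: basis 0) 1 (h 0 1) fg.
  move=> s hs; have := small _ s 0 (lexx _) hs (n0 2); rewrite !z0 => /lt_dd [? _ _ _].
  exact: dO.
have [|c2 c2h E2] := @c1_step O f g (x + h 0 0 *: basis 0 + h 0 1 *: basis 1) 2 (h 0 2) fg.
  move=> s hs; have := small _ _ s (lexx _) (lexx _) hs => /lt_dd [? _ _ _].
  exact: dO.
have := small _ _ _ c0h (n0 1) (n0 2); rewrite !z0 => /lt_dd [_ /H0 h0 _ _].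
have := small _ _ _ (lexx _) c1h (n0 2); rewrite !z0 => /lt_dd [_ _ /H1 h1 _].
have := small _ _ _ (lexx _) (lexx _) c2h => /lt_dd [_ _ _ /H2 h2].
have hE : h + x = x + h 0 0 *: basis 0 + h 0 1 *: basis 1 + h 0 2 *: basis 2.
  rewrite [LHS]addrC -!addrA; congr (_ + _).
  apply/rowP; elim/ord3P; rewrite !mxE /=; ring.
rewrite [X in _ - (_ + X)](_ : _ = h 0 0 * g 0 x + h 0 1 * g 1 x + h 0 2 * g 2 x); last exact: sum3.
set y0 := x + c0 *: basis 0 in E0 h0.
set y1 := _ + c1 *: basis 1 in E1 h1.
set y2 := _ + c2 *: basis 2 in E2 h2.
have -> : f (h + x) - (f x + (h 0 0 * g 0 x + h 0 1 * g 1 x + h 0 2 * g 2 x)) =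
    (g 0 x - g 0 y0) * - h 0 0 + (g 1 x - g 1 y1) * - h 0 1 + (g 2 x - g 2 y2) * - h 0 2.
  rewrite hE; move: E0 E1 E2.
  set A := f (x + h 0 0 *: basis 0 + h 0 1 *: basis 1 + h 0 2 *: basis 2).
  set B := f (x + h 0 0 *: basis 0 + h 0 1 *: basis 1).
  set C := f (x + h 0 0 *: basis 0).
  by move=> e1 e2 e4; lra.
have term i y : `|g i x - g i y| < e / 3 -> `|(g i x - g i y) * - h 0 i| <= e / 3 * `|h|.
  move=> hy; rewrite normrM normrN; apply: ler_pM => //; first exact: ltW.
  exact: norm_coord_le.
apply: le_trans (ler_normD _ _) _.
apply: le_trans (lerD (ler_normD _ _) (lexx _)) _.
have := term _ _ h0; have := term _ _ h1; have := term _ _ h2.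
by lra.
Unshelve. all: by end_near.
Qed.

Lemma c1_schwarz O (f : V -> R) g h x i j : open O -> O x -> c1_at O f g ->
  (forall i, c1_at O (g i) (h i)) -> h i j x = h j i x.
Proof.
move=> oO Ox fg gh.
have [d dp dO] := open_dist oO Ox.
(* Both mixed derivatives are limits of the same second difference quotient. *)
have second k l (t : R) : 0 < t -> t < d / 2 -> exists2 y, `|x - y| <= t + t &
    f (x + t *: basis l + t *: basis k) - f (x + t *: basis k) - (f (x + t *: basis l) - f x) =
    h k l y * t * t.
  move=> t0 td.
  have inO a b : `|a| <= `|t| -> `|b| <= `|t| -> O (x + a *: basis l + b *: basis k).
    move=> ha hb; apply: dO.
    have := dist3 x a b 0 l k k; rewrite scale0r addr0 normr0 addr0 => hd.
    apply: le_lt_trans hd _; move: ha hb; rewrite [`|t|]gtr0_norm// => ha hb; lra.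
  have n0 : `|0 : R| <= `|t| by rewrite normr0.
  have z0 y m : y + 0 *: basis m = y :> V by rewrite scale0r addr0.
  have [|c ct E] := @MVT0 (fun s => f (x + t *: basis l + s *: basis k) - f (x + s *: basis k))
    (fun s => g k (x + t *: basis l + s *: basis k) - g k (x + s *: basis k)) t.
    move=> s st; apply: is_deriveB; apply: is_derive_line.
      by case: (fg _ (inO _ _ (lexx _) st) k).
    by have := inO 0 s n0 st; rewrite z0 => /fg /(_ k) [].
  have [|c' ct' E'] := @c1_step O (g k) (h k) (x + c *: basis k) l t (gh k).
    by move=> s st; rewrite addrAC; exact: inO.
  exists (x + c *: basis k + c' *: basis l).
    have := dist3 x c c' 0 k l l; rewrite scale0r addr0 normr0 addr0 => hd.
    apply: le_trans hd _; move: ct ct'; rewrite [`|t|]gtr0_norm// => ha hb; lra.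
  move: E; rewrite /= !z0 => ->; rewrite -E'; congr (_ * _); congr (g k _ - _).
  by rewrite addrAC.
apply/eqP; rewrite -subr_eq0; apply/negPn/negP => ne.
pose e := `|h i j x - h j i x| / 2.
have e0 : 0 < e by rewrite divr_gt0// normr_gt0.
have [d1 d1p H1] := continuous_dist (gh i x Ox j).2 e0.
have [d2 d2p H2] := continuous_dist (gh j x Ox i).2 e0.
(* A third of the minimum gives both t < d / 2, as [second] requires, and 2 t < d1, d2 for the
   intermediate points. *)
pose t := Num.min d (Num.min d1 d2) / 3.
have dd0 : 0 < Num.min d (Num.min d1 d2) by rewrite !lt_min dp d1p.
have [m1 m2] : Num.min d (Num.min d1 d2) <= d /\ Num.min d (Num.min d1 d2) <= Num.min d1 d2.
  by split; rewrite ge_min lexx ?orbT.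
have [m3 m4] : Num.min d1 d2 <= d1 /\ Num.min d1 d2 <= d2.
  by split; rewrite ge_min lexx ?orbT.
have t0 : 0 < t by rewrite divr_gt0.
have td : t < d / 2 by rewrite /t; lra.
have [y yt Ey] := second i j t t0 td.
have [z zt Ez] := second j i t t0 td.
have yz : h i j y = h j i z.
  have : h i j y * t * t = h j i z * t * t.
    rewrite -Ey -Ez [x + t *: basis i + t *: basis j]addrAC.
    by rewrite !opprB; ring.
  by move=> /(mulIf (lt0r_neq0 t0))/(mulIf (lt0r_neq0 t0)).
have hy : `|h i j x - h i j y| < e by apply: H1; apply: le_lt_trans yt _; rewrite /t; lra.
have hz : `|h j i x - h j i z| < e by apply: H2; apply: le_lt_trans zt _; rewrite /t; lra.
have : `|h i j x - h j i x| < e + e.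
  rewrite (_ : h i j x - h j i x = (h i j x - h i j y) - (h j i x - h j i z)).
    by apply: le_lt_trans (ler_normB _ _) _; exact: ltrD.
  by rewrite yz; ring.
by rewrite /e -splitr ltxx.
Qed.

Lemma is_derive_slice (F : R * V -> R) (t : R) (x v : V) d :
  is_derive (t, x) ((0 : R), v) F d -> is_derive x v (fun y => F (t, y)) d.
Proof.
have E : (fun h : R => h^-1 *: (((fun y => F (t, y)) \o shift x) (h *: v) - F (t, x)))
       = (fun h : R => h^-1 *: ((F \o shift (t, x)) (h *: ((0 : R), v)) - F (t, x))).
  apply/funext => h /=; congr (_ *: (F _ - _)).
  by congr (_, _); rewrite /= scaler0 add0r.
by move=> [df <-]; split; rewrite /derivable /derive /= E.
Qed.

Lemma continuous_pair (t : R) (x : V) : {for x, continuous (fun y : V => (t, y))}.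
Proof.
move=> P [[A B] /= [At Bx] AB]; apply: filterS Bx => y By.
by apply: AB; split=> //; exact: nbhs_singleton.
Qed.

Lemma continuous_slice (F : R * V -> R) (t : R) (x : V) :
  {for (t, x), continuous F} -> {for x, continuous (fun y => F (t, y))}.
Proof. by move=> cF; apply: continuous_comp cF; exact: continuous_pair. Qed.

Lemma open_slice (O : set (R * V)) (t : R) : open O -> open [set x : V | O (t, x)].
Proof.
move=> oO; rewrite openE => x /= Ox.
exact: (continuous_pair (open_nbhs_nbhs (conj oO Ox))).
Qed.

(** Iterated space derivatives at time [t], taken in space-time along directions with zero time
    component, as [smooth_on] provides them. The head of [s] is the derivative applied last. *)
Definition sliced (F : R * V -> R) (s : seq 'I_3) (t : R) (x : V) : R :=
  foldr (fun v h => fun y => 'D_v h y) F [seq ((0 : R), basis i) | i <- s] (t, x).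

Lemma smooth_sliced (O : set (R * V)) F s t : smooth_on O F ->
  c1_at [set x | O (t, x)] (sliced F s t) (fun i => sliced F (i :: s) t).
Proof.
move=> sF x /= Ox i; split.
  apply: is_derive_slice; apply: derivableP.
  by have [_] := sF [seq ((0 : R), basis i) | i <- s] (t, x) Ox; apply.
apply: continuous_slice.
by have [] := sF [seq ((0 : R), basis i) | i <- i :: s] (t, x) Ox.
Qed.

End Smooth.

(** * From smooth solutions to the estimate *)

Section Main.
Context {R : realType}.
Local Notation V := 'rV[R]_3.
Local Notation basis := (@Defs.basis R).
Local Notation Int := (integral3 (@unit_ball R)).

Lemma smooth_upto_cont (I : interval R) (F : R * V -> R) t :
  smooth_upto ([set` I] `*` unit_cball) F -> t \in I -> cont (fun x => F (t, x)).
Proof.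
move=> [ O [_ sub sF]] tI x xB; apply: continuous_slice.
have Otx : O (t, x) by apply: sub; split.
by have [] := sF [::] (t, x) Otx.
Qed.

Lemma smooth_upto_c2_field (I : interval R) (F : 'I_3 -> R * V -> R) t :
  (forall i, smooth_upto ([set` I] `*` unit_cball) (F i)) -> t \in I ->
  c2_field (fun i x => F i (t, x)) (fun i j => sliced (F i) [:: j] t)
    (fun i j k => sliced (F i) [:: k; j] t).
Proof.
move=> sF tI.
have slices i : exists U : set V, [/\ open U, unit_cball `<=` U &
    forall s, c1_at U (sliced (F i) s t) (fun j => sliced (F i) (j :: s) t)].
  have [ O [oO sub sO]] := sF i; exists [set x | O (t, x)]; split.
  - exact: open_slice.
  - by move=> x xB; apply: sub; split.
  - by move=> s; exact: smooth_sliced.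
have diff i s x : unit_cball x -> differentiable (sliced (F i) s t) x.
  by have [U [oU sub c1]] := slices i; move=> /sub Ux; exact: c1_differentiable (c1 s).
have grads i s : has_grad (sliced (F i) s t) (fun j => sliced (F i) (j :: s) t).
  have [U [_ sub c1]] := slices i; split.
  - by move=> x /(diff i s); exact: differentiable_continuous.
  - by move=> j x /(diff i (j :: s)); exact: differentiable_continuous.
  - by move=> x j /sub Ux; case: (c1 s x Ux j).
split.
- by split=> i; [exact: (grads i [::])|exact: (diff i [::])].
- by move=> i j; exact: (grads i [:: j]).
- move=> i j k x xB; have [U [oU sub c1]] := slices i.
  exact: (@c1_schwarz _ U _ (fun j => sliced (F i) [:: j] t)
    (fun j k => sliced (F i) [:: k; j] t) x j k oU (sub _ xB) (c1 [::]) (fun j => c1 [:: j])).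
Qed.

Lemma c2_field_rotB v v' v'' (a : V) : c2_field v v' v'' ->
  c2_field (fun i x => v i x - rot a i x) (fun i j x => v' i j x - rot' a i j x) v''.
Proof.
move=> [cv hv sym]; split=> //.
  by apply: c1_fieldB => //; exact: c1_field_rot.
move=> i j; apply: has_grad_eq (has_gradB (hv i j) (has_grad_cst (rot' a i j 0))) _ _ => //.
by move=> k x; rewrite subr0.
Qed.

Lemma cont_rhobar (gamma rho0 omega : R) : 1 < gamma -> 0 < rho0 ->
  cont (rhobar gamma rho0 omega).
Proof.
move=> g1 r0 x xB; rewrite /rhobar.
set b := fun y : V => rho0 `^ (gamma - 1) +
  (gamma - 1) / (2 * gamma) * omega ^+ 2 * (y 0 0 ^+ 2 + y 0 1 ^+ 2).
have b0 : 0 < b x.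
  have h : 0 <= (gamma - 1) / (2 * gamma) by rewrite divr_ge0//; lra.
  apply: ltr_wpDr; last exact: powR_gt0.
  by apply: mulr_ge0; [rewrite mulr_ge0// sqr_ge0|rewrite addr_ge0// sqr_ge0].
have cb : {for x, continuous b}.
  have h k := @contX R 2 _ (@cont_coord R k).
  exact: (contD (@cont_cst R _) (contM (@cont_cst R _) (contD (h 0) (h 1)))).
have cp : {for b x, continuous (fun s : R => s `^ (gamma - 1)^-1)}.
  have [/derivable1_diffP/differentiable_continuous] := is_derive1_powR (gamma - 1)^-1 b0.
  by [].
exact: (continuous_comp cb cp).
Qed.

Lemma cont_inf_sup (f : V -> R) x : cont f -> unit_ball x ->
  inf (f @` unit_ball) <= f x <= sup (f @` unit_ball).
Proof.
move=> cf xB; have [M _ HM] := cont_bounded cf.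
have bd y : unit_ball y -> `|f y| <= M by move=> /unit_ballW/HM.
apply/andP; split.
  apply: ge_inf; last by exists x.
  by exists (- M) => _ [y /bd + <-]; rewrite ler_norml => /andP[].
apply: ub_le_sup; last by exists x.
by exists M => _ [y /bd + <-]; rewrite ler_norml => /andP[].
Qed.

Lemma ubar_rot omega i (x : V) : ubar omega x 0 i = rot (omega *: basis 2) i x.
Proof.
rewrite /ubar /vec3; elim/ord3P: i; rewrite rotE !mxE /=; ring.
Qed.

Lemma dot_phi_rot (w : 'I_3 -> V -> R) (a x : V) :
  \sum_i w i x * rot a i x = \sum_k a 0 k * \sum_i w i x * phi k x 0 i.
Proof.
rewrite /phi; rewrite [RHS](eq_bigr (fun k => a 0 k * \sum_i w i x * rot (basis k) i x))//.
by rewrite !sum3 !rotE !mxE /=; ring.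
Qed.

Lemma cont_rot a i : cont (rot a i : V -> R).
Proof. by case: (has_grad_rot a i). Qed.

(** Since [rot a] is linear in [a] and [phi k] is the rotation of the [k]-th basis vector, the three
    given momentum identities extend to all rotations as test fields. *)
Lemma Int_momentum_rot (r : V -> R) (w : 'I_3 -> V -> R) (a : V) :
  cont r -> (forall i, cont (w i)) ->
  Int (fun x => r x * \sum_i w i x * rot a i x) =
  \sum_k a 0 k * Int (fun x => r x * \sum_i w i x * phi k x 0 i).
Proof.
move=> cr cw.
have cphi k : cont (fun x => r x * \sum_i w i x * phi k x 0 i).
  apply: contM => //; apply: cont_sum => i; apply: contM => //.
  exact: (@cont_rot (basis k) i).
under [RHS]eq_bigr => k _ do rewrite -integral3Z//.
rewrite -Int_sum; last by move=> k; apply: contM => //; exact: (@cont_cst R _).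
apply: integral3_eq => x _; rewrite dot_phi_rot mulr_sumr.
by apply: eq_bigr => k _; rewrite mulrCA.
Qed.

Lemma has_grad_partial (f : V -> R) g i x : has_grad f g -> unit_ball x ->
  partial i f x = g i x.
Proof. by move=> [_ _ fg] /unit_ballW xB; have := fg x i xB => -[_ <-]. Qed.

(** The indices are swapped: [vgrad] has the derivative index first, [w'] has it second. *)
Lemma vgradE (w : V -> V) w' x i j : (forall i, has_grad (fun y => w y 0 i) (w' i)) ->
  unit_ball x -> vgrad w x i j = w' j i x.
Proof. by move=> hw xB; rewrite mxE (has_grad_partial _ (hw j) xB). Qed.

Lemma sqnorm_vgrad (w : V -> V) w' x : (forall i, has_grad (fun y => w y 0 i) (w' i)) ->
  unit_ball x -> sqnorm (vgrad w x) = \sum_i \sum_j w' i j x ^+ 2.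
Proof.
move=> hw xB; rewrite /sqnorm exchange_big.
by do 2![apply: eq_bigr => ? _]; rewrite (vgradE _ _ hw xB).
Qed.

Lemma sqnorm_strain (w : V -> V) w' x : (forall i, has_grad (fun y => w y 0 i) (w' i)) ->
  unit_ball x -> sqnorm (vgrad w x + (vgrad w x)^T) = strain2 w' x.
Proof.
move=> hw xB; apply: eq_bigr => i _; apply: eq_bigr => j _.
by rewrite mxE [X in _ + X]mxE !(vgradE _ _ hw xB) addrC.
Qed.

Lemma sqnorm_rV (y : V) : sqnorm y = \sum_i y 0 i ^+ 2.
Proof. by rewrite /sqnorm big_ord1. Qed.

Lemma sqnorm_ge0 m n (A : 'M[R]_(m, n)) : 0 <= sqnorm A.
Proof. by do 2![apply: sumr_ge0 => ? _]; exact: sqr_ge0. Qed.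

End Main.

Theorem lemma4 (R : realType) (mu lambda rmin rmax : R) :
  0 < mu -> 0 < lambda ->
  exists C : R, 0 < C /\
  forall (gamma rho0 omega : R) (I : interval R)
    (rho : R -> 'rV[R]_3 -> R) (u : R -> 'rV[R]_3 -> 'rV[R]_3),
  1 < gamma -> 0 < rho0 -> 0 <= omega ->
  inf (rhobar gamma rho0 omega @` unit_ball) = rmin ->
  sup (rhobar gamma rho0 omega @` unit_ball) = rmax ->
  0 < inf (rhobar gamma rho0 omega @` unit_ball) ->
  smooth_slip_solution gamma mu lambda I rho u ->
  (forall (t : R) (i : 'I_3), t \in I ->
     integral3 unit_ball (fun x => rho t x * dot (u t x) (phi i x)) =
     integral3 unit_ball
       (fun x => rhobar gamma rho0 omega x * dot (ubar omega x) (phi i x))) ->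
  forall t : R, t \in I ->
  let lhs :=
    integral3 unit_ball
      (fun x => sqnorm (vgrad (fun y => u t y - ubar omega y) x)) in
  let rhs :=
    integral3 unit_ball (fun x => sqnorm (vgrad (u t) x + (vgrad (u t) x)^T))
    + integral3 unit_ball
        (fun x => sqnorm (ubar omega x)
                  * `|rho t x - rhobar gamma rho0 omega x| ^+ 2)
    + integral3 unit_ball
        (fun x => `|rho t x - rhobar gamma rho0 omega x| ^+ 2
                  * sqnorm (u t x - ubar omega x)) in
  lhs <= C * (rhs + sqnorm (vintegral3 unit_ball (u t))) /\
  lhs <= C * rhs.
Proof.
move=> _ _.
(* The constant is fixed before the steady state is known. For [rmin <= 0] no steady state meets the
   hypotheses and any positive constant serves. *)
have [rmin0|rmin0] := ltP 0 rmin; last first.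
  exists 1; split=> // gamma rho0 omega I rho u _ _ _ -> _.
  by move=> /(le_lt_trans rmin0); rewrite ltxx.
have [C C0 korn] := @korn_momentum R rmin rmax rmin0.
exists C; split=> // gamma rho0 omega I rho u g1 r0 _ inf_rb sup_rb _ sol mom t tI lhs rhs.
(* The bound without the mean of [u] is the stronger one, because the squared mean is
   nonnegative. *)
suff main : lhs <= C * rhs.
  by split=> //; apply: le_trans main _; rewrite ler_pM2l// lerDl sqnorm_ge0.
pose a : 'rV[R]_3 := omega *: Defs.basis 2.
have crho : cont (rho t) := smooth_upto_cont (sol_smooth_rho sol) tI.
have crb : cont (rhobar gamma rho0 omega) by exact: cont_rhobar.
have cu : c2_field (fun i x => u t x 0 i) _ _ := smooth_upto_c2_field (sol_smooth_u sol) tI.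
have cv := c2_field_rotB a cu.
have [[hu _] _ _] := cu; have [[hv _] _ _] := cv.
set v := (fun i x => _ - rot a i x) in cv hv.
have vE i x : v i x = (u t x - ubar omega x) 0 i by rewrite /v -ubar_rot !mxE.
have tv : tangential v.
  move=> x xS; rewrite (eq_bigr (fun i => u t x 0 i * x 0 i - rot a i x * x 0 i)).
    rewrite sumrB rot_tangential// subr0; exact: (sol_no_flux sol tI xS).
  by move=> i _; rewrite mulrBl.
have cr i : cont (rot a i) by exact: cont_rot.
have cu0 i : cont (fun x => u t x 0 i) by case: (hu i).
have momentum b : integral3 unit_ball (fun x => rho t x * \sum_i (v i x + rot a i x) * rot b i x) =
    integral3 unit_ball (fun x => rhobar gamma rho0 omega x * \sum_i rot a i x * rot b i x).
  have cw i : cont (fun x => v i x + rot a i x) by apply: contD => //; case: (hv i).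
  rewrite (Int_momentum_rot b crho cw) (Int_momentum_rot b crb cr).
  apply: eq_bigr => k _; congr (_ * _).
  transitivity (integral3 unit_ball (fun x => rho t x * dot (u t x) (phi k x))).
    by apply: integral3_eq => x _; congr (_ * _); apply: eq_bigr => i _; rewrite subrK.
  rewrite mom//.
  by apply: integral3_eq => x _; congr (_ * _); apply: eq_bigr => i _; rewrite ubar_rot.
have rb_bounds x : unit_ball x -> rmin <= rhobar gamma rho0 omega x <= rmax.
  by rewrite -inf_rb -sup_rb; exact: cont_inf_sup.
have := korn v (rot a) _ _ _ _ cv tv cr crho crb rb_bounds momentum.
congr (_ <= C * (_ + _ + _)); apply: integral3_eq => x xB.
- have hw i := has_grad_eq (hv i) (vE i) (fun _ _ => erefl).
  by rewrite (sqnorm_vgrad hw xB).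
- by rewrite strain2_rotB (sqnorm_strain hu xB).
- rewrite real_normK ?num_real// sqnorm_rV; congr (_ * _).
  by apply: eq_bigr => i _; rewrite ubar_rot.
- rewrite real_normK ?num_real// sqnorm_rV; congr (_ * _).
  by apply: eq_bigr => i _; rewrite vE.
Qed.
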